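(* Let $K$ be a simplicial complex on $[m]$ and $K_1,\ldots,K_m$ simplicial complexes on $n_1,\dots,n_m$ vertices, respectively. Then the non-trivial Steenrod operations on $K,K_1,\ldots,K_m$ give rise to non-trivial Steenrod operations on the moment-angle complex over the substitution complex $K\langle K_1,\ldots,K_m\rangle$; that is, for $n\ge1$, if $Sq^n$ is non-zero on the cohomology of at least one of $K,K_1,\dots,K_m$, then $Sq^n$ is non-zero on $H^*(\mathcal Z_{K\langle K_1,\ldots,K_m\rangle})$.
   Context: $H^*(-)$ denotes cohomology with $\mathbb F_2$ coefficients (of the geometric realization, for simplicial complexes), and $Sq^n$ is the $n$-th mod 2 Steenrod square. A simplicial complex on $[m]=\{1,\dots,m\}$ contains $\emptyset$ and has vertices labelled by $[m]$. For $K$ on $[m]$ and $K_i$ on $[n_i]$, the substitution complex $K\langle K_1,\ldots,K_m\rangle$ is the polyhedral join $(K_i,\emptyset)^{*K}$, i.e. the simplicial complex on vertices $v_{i,j}$ ($i\in[m]$, $j\in[n_i]$) whose simplices are exactly the joins (disjoint unions) $\tau_{i_1}*\cdots*\tau_{i_k}$ with $\{i_1,\dots,i_k\}\in K$ and $\tau_{i_j}\in K_{i_j}$, where the vertices of $K_i$ are identified with $v_{i,1},\dots,v_{i,n_i}$. For a simplicial complex $M$ on $[r]$, the moment-angle complex is $\mathcal Z_M=(D^2,S^1)^M=\bigcup_{\sigma\in M}\prod_{i=1}^rY_i^\sigma\subseteq(D^2)^r$ with $Y_i^\sigma=D^2$ if $i\in\sigma$ and $Y_i^\sigma=S^1$ if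 $i\notin\sigma$. *)

(* Defs.v *)
From HB Require Import structures.
From mathcomp Require Import all_boot all_order all_algebra zify.
Set Implicit Arguments.
Unset Strict Implicit.
Unset Printing Implicit Defensive.
Import Order.TTheory GRing.Theory Num.Theory.
Local Open Scope ring_scope.

(* Every element of V is a vertex: there are no ghost vertices. *)
Record simplicial_complex (V : finType) := SimplicialComplex {
  faces : {set {set V}};
  faces_set0 : set0 \in faces;
  faces_set1 : forall v, [set v] \in faces;
  faces_sub : forall s t : {set V}, s \subset t -> t \in faces -> s \in faces
}.

Section Substitution.
Variables (I : finType) (V : I -> finType).
Variables (K : simplicial_complex I) (L : forall i, simplicial_complex (V i)).

(* The disjoint union of the t i for i in s; the values of t outside s are
   irrelevant. *)
Definition join_faces (s : {set I}) (t : {dffun forall i, {set V i}}) :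
  {set {i : I & V i}} := [set v | (tag v \in s) && (tagged v \in t (tag v))].

Definition subst_faces : {set {set {i : I & V i}}} :=
  [set r | [exists s in faces K, exists t : {dffun forall i, {set V i}},
     [forall i in s, t i \in faces (L i)] && (r == join_faces s t)]].

Lemma subst_facesP r : reflect
  (exists2 s, s \in faces K & exists2 t : {dffun forall i, {set V i}},
     {in s, forall i, t i \in faces (L i)} & r = join_faces s t)
  (r \in subst_faces).
Proof.
rewrite inE; apply: (iffP exists_inP) => -[s sK].
  by case/existsP=> t /andP[/forall_inP tL /eqP->]; exists s => //; exists t.
case=> t tL ->; exists s => //; apply/existsP; exists t.
by rewrite eqxx andbT; apply/forall_inP.
Qed.

Lemma subst_set0 : set0 \in subst_faces.
Proof.
apply/subst_facesP; exists set0; first exact: faces_set0.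
exists [ffun i => set0] => [i|]; first by rewrite inE.
by apply/setP=> v; rewrite !inE.
Qed.

Lemma subst_sub (s t : {set {i : I & V i}}) : s \subset t -> t \in subst_faces -> s \in subst_faces.
Proof.
move=> st /subst_facesP[a aK [b bL tE]]; apply/subst_facesP; exists a => //.
exists [ffun i => [set w in b i | Tagged V w \in s]] => [i ia|].
  rewrite ffunE; apply: faces_sub (bL i ia).
  by apply/subsetP=> w; rewrite inE => /andP[].
apply/setP=> -[i w]; rewrite inE /= ffunE inE.
rewrite -[existT _ _ _]/(Tagged V w); case: (boolP (Tagged V w \in s)) => ws; last by rewrite !andbF.
by rewrite andbT; move/subsetP: st => /(_ _ ws); rewrite tE inE /= => /andP[-> ->].
Qed.

Lemma subst_set1 v : [set v] \in subst_faces.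
Proof.
apply/subst_facesP; exists [set tag v]; first exact: faces_set1.
exists [ffun i => [set w | Tagged V w == v]] => [i|].
  rewrite inE ffunE => /eqP->; case: v => i0 w0 /=.
  suff -> : [set w | Tagged V w == existT _ i0 w0] = [set w0] by exact: faces_set1.
  by apply/setP=> w; rewrite !inE -[existT _ _ _]/(Tagged V w0) eq_Tagged.
apply/setP=> -[i w]; rewrite !inE /= ffunE inE.
by rewrite andb_idl // => /eqP<-.
Qed.

Definition substitution : simplicial_complex {i : I & V i} :=
  SimplicialComplex subst_set0 subst_set1 subst_sub.

End Substitution.

Section Sides.
Variable N : nat.
Implicit Types (J : {set 'I_N.+1}) (v w : 'I_N.+1).

(* For J = {j_0 < ... < j_i}, side J false is the union of the intervals
   [0, j_0], [j_1, j_2], [j_3, j_4], ... and side J true is the union of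
   [j_0, j_1], [j_2, j_3], ..., the last interval ending at N. *)
Definition side J (e : bool) : {set 'I_N.+1} :=
  [set v | (v \in J) || (odd #|[set j in J | (j < v)%N]| == e)].

Definition rank_lt J v : nat := #|[set j in J | (j < v)%N]|.

Lemma F2_addrr (x : 'F_2) : x + x = 0.
Proof. by rewrite (addrr_pchar2 (pchar_Fp (isT : prime 2))). Qed.

Lemma leq_neq_ord v w : w != v -> (v <= w)%N = (v < w)%N.
Proof. by move=> nwv; rewrite [RHS]ltn_neqAle val_eqE eq_sym nwv. Qed.

(* side J e with the two sides exchanged at the v >= c outside J *)
Definition cut J (c : nat) (e : bool) : {set 'I_N.+1} :=
  [set v | (v \in J) || (odd (rank_lt J v) (+) (c <= v)%N == e)].

Lemma cut_max J e : cut J N.+1 e = side J e.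
Proof. by apply/setP=> v; rewrite !inE leqNgt ltn_ord addbF. Qed.

Lemma cut_0 J e : cut J 0 e = side J (~~ e).
Proof. by apply/setP=> v; rewrite !inE leq0n addbT -/(rank_lt J v); case: odd; case: e. Qed.

Lemma cut_in J v e : v \in J -> cut J v.+1 e = cut J v e.
Proof.
move=> vJ; apply/setP=> w; rewrite !inE.
have [->|] := eqVneq w v; first by rewrite vJ.
by move=> nwv; rewrite leq_neq_ord.
Qed.

Lemma rank_ltU J v w : v \notin J -> rank_lt (v |: J) w = ((v < w) + rank_lt J w)%N.
Proof.
move=> vJ; rewrite /rank_lt; case: (ltnP v w) => vw.
  rewrite -[X in _ = (X + _)%N]/(1%N).
  rewrite (_ : [set j in v |: J | (j < w)%N] = v |: [set j in J | (j < w)%N]).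
    by rewrite cardsU1 inE (negPf vJ).
  by apply/setP=> j; rewrite !inE; case: eqVneq => // ->; rewrite vw.
rewrite add0n; congr #|pred_of_set _|; apply/setP=> j; rewrite !inE.
by case: eqVneq => //= ->; rewrite ltnNge vw !andbF.
Qed.

Lemma sideU J v e : v \notin J -> side (v |: J) e = v |: cut J v e.
Proof.
move=> vJ; apply/setP=> w; rewrite !inE -/(rank_lt _ _) rank_ltU //.
by case: eqVneq => //= nwv; rewrite leq_neq_ord // oddD oddb addbC.
Qed.

Lemma mem_cut J v e : v \notin J -> (v \in cut J v e) = (odd (rank_lt J v) != e).
Proof. by move=> vJ; rewrite inE (negPf vJ) leqnn addbT; case: odd; case: e. Qed.

Lemma cutS J v e : v \notin J ->
  cut J v.+1 e = if v \in cut J v e then cut J v e :\ v else v |: cut J v e.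
Proof.
move=> vJ; rewrite mem_cut //; apply/setP=> w.
have [->|nwv] := eqVneq w v.
  rewrite !inE (negPf vJ) ltnn addbF /=.
  by case: eqVneq => [|]; rewrite !inE eqxx.
have -> : (w \in cut J v.+1 e) = (w \in cut J v e).
  by rewrite !inE leq_neq_ord.
by case: ifP; rewrite !inE (negPf nwv).
Qed.

Variables g h : {set 'I_N.+1} -> 'F_2.

Definition cupset k := \sum_(J : {set 'I_N.+1} | #|J| == k) g (side J false) * h (side J true).

Let T J c := g (cut J c false) * h (cut J c true).

Lemma cut_step J v : v \notin J ->
  let J' := v |: J in
  g (side J' false :\ v) * h (side J' true) + g (side J' false) * h (side J' true :\ v)
  = T J v + T J v.+1.
Proof.
move=> vJ /=; rewrite !sideU // /T !cutS // !mem_cut //.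
have memF := mem_cut false vJ; have memT := mem_cut true vJ.
move: memF memT; set A := cut J v false; set B := cut J v true.
case: (odd _) => /= vA vB.
  by rewrite (setUidPr (_ : [set v] \subset A)) ?sub1set // setU1K ?vB // addrC.
by rewrite (setUidPr (_ : [set v] \subset B)) ?sub1set // setU1K ?vA.
Qed.

Lemma cut_telescope J :
  \sum_(v | v \notin J) (T J v + T J v.+1) = T J 0 + T J N.+1.
Proof.
have -> : \sum_(v | v \notin J) (T J v + T J v.+1)
          = \sum_(v < N.+1) (T J v.+1 - T J v).
  rewrite [RHS](bigID (mem J)) /= [X in _ = X + _]big1 ?add0r.
    apply: eq_bigr => v _.
    by rewrite (oppr_pchar2 (pchar_Fp (isT : prime 2))) addrC.
  by move=> v vJ; rewrite /T !cut_in ?subrr.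
rewrite -(big_mkord xpredT (fun c => T J c.+1 - T J c)) telescope_sumr //.
by rewrite (oppr_pchar2 (pchar_Fp (isT : prime 2))) addrC.
Qed.

Lemma side_only J v : v \notin J ->
  (v \in side J true) = (v \notin side J false).
Proof. by move=> vJ; rewrite !inE (negPf vJ) /=; case: odd. Qed.

Lemma side_sub J v e : v \in J -> v \in side J e.
Proof. by move=> vJ; rewrite !inE vJ. Qed.

Lemma setD1_id (A : {set 'I_N.+1}) v : v \notin A -> A :\ v = A.
Proof. by move=> vA; apply/setDidPl; rewrite disjoint_sym disjoints1. Qed.

Lemma cupset_coboundary k :
  \sum_(J : {set 'I_N.+1} | #|J| == k) \sum_(v | v \notin J)
      g (side J false :\ v) * h (side J true :\ v)
  + (\sum_(J : {set 'I_N.+1} | #|J| == k)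
       (\sum_(v in side J false) g (side J false :\ v)) * h (side J true)
   + \sum_(J : {set 'I_N.+1} | #|J| == k)
       g (side J false) * (\sum_(v in side J true) h (side J true :\ v)))
  = \sum_(J : {set 'I_N.+1} | #|J| == k) \sum_(v in J)
      (g (side J false :\ v) * h (side J true)
       + g (side J false) * h (side J true :\ v)).
Proof.
rewrite -!big_split /=; apply: eq_bigr => J _.
rewrite mulr_suml mulr_sumr.
rewrite !(big_mkcond (fun v => v \in _)) (big_mkcond (fun v => v \notin J)) /=.
rewrite -!big_split /=; apply: eq_bigr => v _.
have [vJ|vJ] := boolP (v \in J); first by rewrite !side_sub // add0r.
rewrite side_only //; have [vA|vA] /= := boolP (v \in side J false).
  by rewrite addr0 [side J true :\ v]setD1_id ?F2_addrr // side_only // negbK.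
by rewrite add0r [side J false :\ v]setD1_id ?F2_addrr.
Qed.

End Sides.

Lemma cupset_insert N (g h : {set 'I_N.+1} -> 'F_2) k :
  \sum_(J : {set 'I_N.+1} | #|J| == k.+1) \sum_(v in J)
      (g (side J false :\ v) * h (side J true)
       + g (side J false) * h (side J true :\ v))
  = cupset g h k + cupset h g k.
Proof.
pose F (J : {set 'I_N.+1}) v := g (side J false :\ v) * h (side J true)
       + g (side J false) * h (side J true :\ v).
transitivity (\sum_(I : {set 'I_N.+1} | #|I| == k) \sum_(v | v \notin I) F (v |: I) v).
  rewrite !pair_big_dep /=.
  rewrite (reindex_onto (fun x : {set 'I_N.+1} * 'I_N.+1 => (x.2 |: x.1, x.2))
                        (fun x => (x.1 :\ x.2, x.2))) /=; last first.
    by move=> [J v] /= /andP[_ vJ]; rewrite setD1K.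
  apply: eq_bigl => -[I v] /=; rewrite setU11 andbT xpair_eqE eqxx andbT cardsU1.
  case: (boolP (v \in I)) => vI /=.
    rewrite andbF; apply/negbTE; rewrite negb_and orbC; apply/orP; left.
    by apply: contraTneq vI => <-; rewrite !inE eqxx.
  by rewrite setU1K // eqxx andbT add1n eqSS.
rewrite /cupset -big_split /=; apply: eq_bigr => I _.
rewrite (eq_bigr _ (fun v vI => cut_step g h vI)).
by rewrite cut_telescope !cut_0 !cut_max addrC mulrC [in X in _ + X]mulrC.
Qed.

Lemma sorted_enum_set n (A : {set 'I_n}) : sorted (fun i j : 'I_n => (i < j)%N) (enum A).
Proof.
have tr : transitive (fun i j : 'I_n => (i < j)%N) by move=> ? ? ?; exact: ltn_trans.
rewrite /enum_mem -enumT; apply: (sorted_filter tr).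
by rewrite -[sorted _ _]/(sorted (relpre val ltn) _) -sorted_map val_enum_ord iota_ltn_sorted.
Qed.

Lemma enum_lift n (v : 'I_n.+1) (A : {set 'I_n}) :
  enum (lift v @: A) = map (lift v) (enum A).
Proof.
apply: (@irr_sorted_eq _ (fun i j : 'I_n.+1 => (i < j)%N)).
- by move=> ? ? ?; exact: ltn_trans.
- by move=> ?; exact: ltnn.
- exact: sorted_enum_set.
- rewrite sorted_map; apply: sub_sorted (sorted_enum_set A) => i j /=.
  by rewrite /bump => ij; case: (leqP v i) => vi; case: (leqP v j) => vj; lia.
- move=> i; rewrite mem_enum; apply/imsetP/mapP => -[j jA ->]; exists j => //.
    by rewrite mem_enum.
  by rewrite -mem_enum.
Qed.

Lemma nth_enum_setD1 n (x0 : 'I_n) (A : {set 'I_n}) k i : (k < #|A|)%N ->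
  nth x0 (enum (A :\ nth x0 (enum A) k)) i = nth x0 (enum A) (bump k i).
Proof.
rewrite cardE => kA; set v := nth x0 (enum A) k.
have -> : enum (A :\ v) = rem v (enum A).
  rewrite rem_filter ?enum_uniq // /enum_mem -filter_predI.
  by apply: eq_filter => j; rewrite /= !inE.
rewrite remE index_uniq ?enum_uniq // nth_cat size_take kA /bump.
case: ltnP => ik; first by rewrite nth_take // leqNgt ik.
by rewrite nth_drop addSn subnKC.
Qed.

Lemma sum_enum_set (V : nmodType) n (x0 : 'I_n) (A : {set 'I_n}) m (F : 'I_n -> V) : #|A| = m ->
  \sum_(v in A) F v = \sum_(k < m) F (nth x0 (enum A) k).
Proof.
move=> <-; rewrite -big_enum (big_nth x0) /= -cardE big_mkord.
by apply: eq_bigr.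
Qed.

Lemma side_lift N (v : 'I_N.+2) (J : {set 'I_N.+1}) e :
  side (lift v @: J) e :\ v = lift v @: side J e.
Proof.
apply/setP=> w; rewrite !inE.
case: (unliftP v w) => [j ->|->]; last first.
  rewrite eqxx; symmetry; apply/negbTE/imsetP => -[j _ /eqP].
  by rewrite (negPf (neq_lift _ _)).
rewrite eq_sym neq_lift !mem_imset ?inE //=; try exact: lift_inj.
congr (_ || (odd _ == _)).
rewrite -(card_imset (mem [set j0 in J | (j0 < j)%N]) (@lift_inj _ v)).
apply: eq_card => i; rewrite !inE.
case: (unliftP v i) => [k ->|->].
  rewrite !mem_imset ?inE; try exact: lift_inj.
  by rewrite /= /bump; congr (_ && _); lia.
transitivity false; last symmetry.
  apply/negbTE; rewrite negb_and; apply/orP; left.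
  by apply/imsetP => -[k _ /eqP]; rewrite (negPf (neq_lift _ _)).
by apply/negbTE/imsetP => -[k _ /eqP]; rewrite (negPf (neq_lift _ _)).
Qed.

Lemma sum_lift_set N (V : nmodType) (v : 'I_N.+2) k (F : {set 'I_N.+2} -> V) :
  \sum_(J : {set 'I_N.+1} | #|J| == k) F (lift v @: J)
  = \sum_(J : {set 'I_N.+2} | (#|J| == k) && (v \notin J)) F J.
Proof.
have li := @lift_inj _ v.
rewrite [RHS](reindex_onto (fun J : {set 'I_N.+1} => lift v @: J) (fun J => lift v @^-1: J)) /=.
  apply: eq_bigl => J; rewrite card_imset //.
  case: (_ == _) => //=; symmetry; apply/andP; split.
    by apply/imsetP => -[j _ /eqP]; rewrite (negPf (neq_lift _ _)).
  by apply/eqP/setP=> j; rewrite inE mem_imset.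
move=> J /andP[_ vJ]; apply/setP=> i.
case: (unliftP v i) => [j ->|->]; first by rewrite mem_imset // inE.
rewrite (negPf vJ); apply/negbTE/imsetP => -[j _ /eqP].
by rewrite (negPf (neq_lift _ _)).
Qed.

From mathcomp Require Import all_classical all_reals topology normedtype.
Import numFieldNormedType.Exports.
Local Open Scope classical_set_scope.

Lemma continuous_ptws (X U : topologicalType) (I : choiceType) (f : X -> {ptws I -> U}) :
  (forall i, continuous (fun x => f x i)) -> continuous f.
Proof.
move=> cf x; apply/cvg_sup => i; move: x.
exact: (@continuous_comp_initial _ _ _ (fun g : {ptws I -> U} => g i) f (cf i)).
Qed.

Lemma continuous_sum (X : topologicalType) (R : realType) (I : Type) (r : seq I)
    (P : pred I) (F : I -> X -> R) :
  (forall i, continuous (F i)) -> continuous (fun x => \sum_(i <- r | P i) F i x).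
Proof.
move=> cF; elim: r => [|i r IH] y.
  by under eq_fun do rewrite big_nil; exact: cvg_cst.
under eq_fun do rewrite big_cons.
by case: ifP => _; [apply: cvgD; [exact: cF | exact: IH] | exact: IH].
Qed.

Section Singular.
Variables (R : realType).

Definition std_simplex (n : nat) : set {ptws 'I_n.+1 -> R} :=
  [set x | (forall i, 0 <= x i) /\ \sum_i x i = 1].

Arguments std_simplex : clear implicits.
Section SimplexMap.
Variables (p q : nat) (f : 'I_p.+1 -> 'I_q.+1).

(* The affine map sending the k-th vertex to the (f k)-th vertex. *)
Definition push (x : {ptws 'I_p.+1 -> R}) : {ptws 'I_q.+1 -> R} :=
  fun j => \sum_(i | f i == j) x i.

Lemma push_simplex (x : std_simplex p) : (push (set_val x)) \in std_simplex q.
Proof.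
rewrite inE; have [x0 x1] := set_valP x; split=> [j|]; first by apply: sumr_ge0 => i _; exact: x0.
rewrite -x1 (partition_big f predT) //=.
Qed.

Definition simplex_map (x : std_simplex p) : std_simplex q :=
  SigSub (push_simplex x).

Lemma simplex_map_continuous : continuous simplex_map.
Proof.
apply: continuous_comp_initial; apply: continuous_ptws => j.
have coord i : continuous (fun y : std_simplex p => set_val y i : R).
  move=> y; apply: (@continuous_comp _ _ _ set_val (fun g : {ptws 'I_p.+1 -> R} => g i)).
    exact: initial_continuous.
  exact: proj_continuous.
exact: (@continuous_sum _ _ _ _ _ (fun i (y : std_simplex p) => set_val y i)).
Qed.
End SimplexMap.

Lemma simplex_map_id p : @simplex_map p p id = id.
Proof.
by apply/funext => x; apply: val_inj; apply/funext => j; rewrite /= /push big_pred1_eq.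
Qed.

Lemma simplex_map_comp p q r (f : 'I_p.+1 -> 'I_q.+1) (g : 'I_q.+1 -> 'I_r.+1) x :
  simplex_map g (simplex_map f x) = simplex_map (g \o f) x.
Proof.
apply: val_inj; apply/funext => j /=; rewrite /push.
rewrite [RHS](partition_big f (fun k => g k == j)) //=.
apply: eq_bigr => k /eqP<-; apply: eq_bigl => i.
by case: eqP => [->|]; rewrite ?eqxx ?andbF.
Qed.

Variable T : topologicalType.

Definition sing (n : nat) := continuousType (std_simplex n) T.

Definition sing_map p q (f : 'I_p.+1 -> 'I_q.+1) (s : sing q) : sing p :=
  s \o mkcts (@simplex_map_continuous p q f).

Lemma sing_map_comp p q r (f : 'I_p.+1 -> 'I_q.+1) (g : 'I_q.+1 -> 'I_r.+1) s :
  sing_map f (sing_map g s) = sing_map (g \o f) s.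
Proof. by apply/continuousEP => x /=; rewrite /mkcts simplex_map_comp. Qed.

Lemma sing_map_id p (s : sing p) : sing_map id s = s.
Proof. by apply/continuousEP => x /=; rewrite /mkcts simplex_map_id. Qed.

Definition cochain (q : nat) := sing q -> 'F_2.
HB.instance Definition _ q := GRing.Zmodule.on (cochain q).

Definition coboundary q (a : cochain q) : cochain q.+1 :=
  fun s => \sum_(v < q.+2) a (sing_map (lift v) s).

(* The value of a on the face of s spanned by the vertices in A, and 0 when
   this face does not have dimension p. The enumeration of A is increasing, so
   ord0 is never reached. *)
Definition eval_on p N (a : cochain p) (s : sing N) (A : {set 'I_N.+1}) : 'F_2 :=
  if #|A| == p.+1 then a (sing_map (fun k : 'I_p.+1 => nth ord0 (enum A) k) s)
  else 0.

(* Steenrod's cup-i product, mod 2: the sum over j_0 < ... < j_i of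
   a(side J false) * b(side J true). The only relevant degree is N = p + q - i;
   in any other degree the product vanishes, because
   #|side J false| + #|side J true| = N + 1 + (i + 1). *)
Definition cup (i p q N : nat) (a : cochain p) (b : cochain q) : cochain N :=
  fun s => \sum_(J : {set 'I_N.+1} | #|J| == i.+1)
             eval_on a s (side J false) * eval_on b s (side J true).
Arguments cup i {p q} N a b _.


Lemma coboundaryB q (a b : cochain q) : coboundary (a - b) = coboundary a - coboundary b.
Proof. by apply/funext => s; exact: sumrB. Qed.

Lemma coboundary0 q : coboundary (0 : cochain q) = 0.
Proof. by rewrite -[X in coboundary X](subrr 0) coboundaryB subrr. Qed.

Lemma coboundaryD q (a b : cochain q) : coboundary (a + b) = coboundary a + coboundary b.
Proof. by apply/funext => s; exact: big_split. Qed.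

Lemma cochain_addrr q (a : cochain q) : a + a = 0.
Proof. by apply/funext => s; exact: F2_addrr. Qed.

Lemma cochain_oppr q (a : cochain q) : - a = a.
Proof. by apply/eqP; rewrite eq_sym -subr_eq0 opprK cochain_addrr. Qed.

Lemma eval_onD p N (a b : cochain p) (s : sing N) A :
  eval_on (a + b) s A = eval_on a s A + eval_on b s A.
Proof. by rewrite /eval_on; case: ifP => // _; rewrite addr0. Qed.

Lemma eval_on0 p N (s : sing N) A : eval_on (0 : cochain p) s A = 0.
Proof. by rewrite /eval_on; case: ifP. Qed.

Lemma eval_on_set0 p N (a : cochain p) (s : sing N) : eval_on a s finset.set0 = 0.
Proof. by rewrite /eval_on cards0. Qed.

Lemma eval_on_lift p N (a : cochain p) (s : sing N.+1) (v : 'I_N.+2) (A : {set 'I_N.+1}) :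
  eval_on a (sing_map (lift v) s) A = eval_on a s (lift v @: A).
Proof.
rewrite /eval_on card_imset; last exact: lift_inj.
case: eqP => // Ap; congr a; rewrite sing_map_comp; congr (sing_map _ s).
by apply/funext => k /=; rewrite enum_lift (nth_map ord0) // -cardE Ap.
Qed.

Lemma eval_on_coboundary p N (a : cochain p) (s : sing N) A :
  eval_on (coboundary a) s A = \sum_(v in A) eval_on a s (A :\ v)%SET.
Proof.
rewrite {1}/eval_on; case: eqP => Ap.
  rewrite (sum_enum_set ord0 _ Ap) /coboundary; apply: eq_bigr => k _.
  have kA : (k < #|A|)%N by rewrite Ap.
  have vA : nth ord0 (enum A) k \in A by rewrite -mem_enum mem_nth // -cardE.
  move: Ap; rewrite (cardsD1 (nth ord0 (enum A) k)) vA add1n => -[Ap].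
  rewrite /eval_on Ap eqxx; congr a.
  rewrite sing_map_comp; congr (sing_map _ s); apply/funext => i /=.
  by rewrite nth_enum_setD1.
rewrite big1 // => v vA; rewrite /eval_on; case: eqP => // Av; case: Ap.
by rewrite (cardsD1 v) vA Av.
Qed.

Lemma eval_on_setT p (a : cochain p) (s : sing p) : eval_on a s [set: 'I_p.+1]%SET = a s.
Proof.
rewrite /eval_on cardsT card_ord eqxx; congr a.
rewrite -[RHS]sing_map_id; congr sing_map; apply/funext => k.
rewrite (_ : enum [set: 'I_p.+1]%SET = enum 'I_p.+1) ?nth_ord_enum //.
by apply: eq_enum => i; rewrite !inE.
Qed.

Lemma coboundaryK q (a : cochain q) : coboundary (coboundary a) = 0.
Proof.
apply/funext => s; pose f (v w : 'I_q.+3) := eval_on a s (~: [set v] :\ w)%SET.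
transitivity (\sum_v \sum_(w | w != v) f v w).
  apply: eq_bigr => v _; rewrite -[LHS]eval_on_setT eval_on_lift.
  have -> : lift v @: [set: 'I_q.+2]%SET = (~: [set v])%SET.
    apply/setP=> i; rewrite !inE; case: (unliftP v i) => [j ->|->].
      by rewrite mem_imset ?inE ?[lift v j == v]eq_sym ?neq_lift //; exact: lift_inj.
    by rewrite eqxx; apply/negbTE/imsetP => -[j _ /eqP]; rewrite (negPf (neq_lift _ _)).
  by rewrite eval_on_coboundary; apply: eq_bigl => w; rewrite !inE.
have fC v w : f v w = f w v.
  by rewrite /f; congr eval_on; apply/setP=> i; rewrite !inE andbC.
have lt_split : \sum_v \sum_(w | w != v) f v w =
    \sum_(v : 'I_q.+3) \sum_(w : 'I_q.+3 | (w < v)%N) f v w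
    + \sum_(v : 'I_q.+3) \sum_(w : 'I_q.+3 | (v < w)%N) f v w.
  rewrite -big_split; apply: eq_bigr => v _ /=.
  rewrite (bigID (fun w : 'I_q.+3 => (w < v)%N)) /=; congr (_ + _); apply: eq_bigl => w;
    by rewrite -val_eqE /=; case: ltngtP.
rewrite lt_split [X in _ + X](exchange_big_dep xpredT) //=.
under [X in _ + X]eq_bigr => w _ do under eq_bigr => v _ do rewrite fC.
exact: F2_addrr.
Qed.

Lemma cupE i p q N (a : cochain p) (b : cochain q) (s : sing N) :
  cup i N a b s = cupset (eval_on a s) (eval_on b s) i.+1.
Proof. by []. Qed.

Lemma coboundary_cup_step i p q N (a : cochain p) (b : cochain q) (s : sing N.+1) :
  coboundary (cup i N a b) s
  + (cup i N.+1 (coboundary a) b s + cup i N.+1 a (coboundary b) s)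
  = cupset (eval_on a s) (eval_on b s) i + cupset (eval_on b s) (eval_on a s) i.
Proof.
rewrite -cupset_insert -cupset_coboundary; congr (_ + (_ + _)).
- rewrite /coboundary /cup.
  transitivity (\sum_(v < N.+2) \sum_(J : {set 'I_N.+2} | (#|J| == i.+1) && (v \notin J))
     eval_on a s (side J false :\ v)%SET * eval_on b s (side J true :\ v)%SET).
    apply: eq_bigr => v _; rewrite -sum_lift_set; apply: eq_bigr => J _.
    by rewrite !eval_on_lift !side_lift.
  rewrite (exchange_big_dep (fun J : {set 'I_N.+2} => #|J| == i.+1)) /=.
    by apply: eq_bigr => J Ji; apply: eq_bigl => v; rewrite Ji.
  by move=> v J _ /andP[].
- by apply: eq_bigr => J _; rewrite eval_on_coboundary.
- by apply: eq_bigr => J _; rewrite eval_on_coboundary.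
Qed.

Lemma cupset0 p q N (a : cochain p) (b : cochain q) (s : sing N) :
  cupset (eval_on a s) (eval_on b s) 0 = 0.
Proof.
apply: big1 => J; rewrite cards_eq0 => /eqP->.
rewrite (_ : side finset.set0 true = finset.set0) ?eval_on_set0 ?mulr0 //.
apply/setP=> v; rewrite !inE (_ : [set j in finset.set0 | _]%SET = finset.set0) ?cards0 //.
by apply/setP=> j; rewrite !inE.
Qed.

Lemma F2_move (x y z : 'F_2) : x + y = z -> x = y + z.
Proof. by move=> <-; rewrite addrCA F2_addrr addr0. Qed.

Lemma coboundary_cup0 p q N (a : cochain p) (b : cochain q) :
  coboundary (cup 0 N a b) = cup 0 N.+1 (coboundary a) b + cup 0 N.+1 a (coboundary b).
Proof.
apply/funext => s; have := coboundary_cup_step 0 a b s.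
by rewrite !cupset0 addr0 => /F2_move->; rewrite addr0.
Qed.

(* mod 2, d(a u_i b) = da u_i b + a u_i db + a u_(i-1) b + b u_(i-1) a *)
Lemma coboundary_cup i p q N (a : cochain p) (b : cochain q) :
  coboundary (cup i.+1 N a b) =
    cup i.+1 N.+1 (coboundary a) b + cup i.+1 N.+1 a (coboundary b)
    + (cup i N.+1 a b + cup i N.+1 b a).
Proof.
apply/funext => s; have := coboundary_cup_step i.+1 a b s.
by move=> /F2_move->.
Qed.

Lemma cupDl i p q N (a a' : cochain p) (b : cochain q) :
  cup i N (a + a') b = cup i N a b + cup i N a' b.
Proof.
apply/funext => s; transitivity (cup i N a b s + cup i N a' b s) => //.
rewrite /cup -big_split; apply: eq_bigr => J _ /=.
by rewrite eval_onD mulrDl.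
Qed.

Lemma cupDr i p q N (a : cochain p) (b b' : cochain q) :
  cup i N a (b + b') = cup i N a b + cup i N a b'.
Proof.
apply/funext => s; transitivity (cup i N a b s + cup i N a b' s) => //.
rewrite /cup -big_split; apply: eq_bigr => J _ /=.
by rewrite eval_onD mulrDr.
Qed.

Lemma cup0l i p q N (b : cochain q) : cup i N (0 : cochain p) b = 0.
Proof. by apply/funext => s; apply: big1 => J _; rewrite eval_on0 mul0r. Qed.

Lemma cup0r i p q N (a : cochain p) : cup i N a (0 : cochain q) = 0.
Proof. by apply/funext => s; apply: big1 => J _; rewrite eval_on0 mulr0. Qed.

Definition is_cocycle q : {pred cochain q} := [pred a | coboundary a == 0].

Definition is_coboundary q : cochain q -> Prop :=
  match q with
  | 0 => fun a : cochain 0 => a = 0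
  | p.+1 => fun a : cochain p.+1 => exists b : cochain p, a = coboundary b
  end.

Lemma is_cocycle_zmod q : zmod_closed (@is_cocycle q).
Proof.
split=> [|a b]; first by rewrite inE coboundary0.
by move=> /eqP da /eqP db; apply/eqP; rewrite coboundaryB da db subrr.
Qed.
HB.instance Definition _ q :=
  GRing.isZmodClosed.Build (cochain q) (@is_cocycle q) (@is_cocycle_zmod q).

Record cocycle (q : nat) := Cocycle {
  cocycle_val :> cochain q;
  cocycleP : cocycle_val \in @is_cocycle q
}.
HB.instance Definition _ q := [isSub for @cocycle_val q].
HB.instance Definition _ q := [Choice of cocycle q by <:].
HB.instance Definition _ q := [SubChoice_isSubZmodule of cocycle q by <:].

Definition exact_cocycle q : {pred cocycle q} :=
  fun a => `[< is_coboundary (cocycle_val a) >].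

Lemma exact_cocycle_zmod q : zmod_closed (@exact_cocycle q).
Proof.
split=> [|a b].
  by apply/asboolP; case: q => //= q; exists 0; rewrite coboundary0.
move=> /asboolP + /asboolP; rewrite -topredE /= => ha hb; apply/asboolP; move: ha hb.
case: q a b => [|q] a b /=; first by move=> /= -> ->; rewrite subrr.
by move=> -[a' ->] [b' ->]; exists (a' - b'); rewrite coboundaryB.
Qed.
HB.instance Definition _ q :=
  GRing.isZmodClosed.Build (cocycle q) (@exact_cocycle q) (@exact_cocycle_zmod q).

Definition cohomology (q : nat) := @Quotient.quot (cocycle q) (@exact_cocycle q).
HB.instance Definition _ q := GRing.Zmodule.on (cohomology q).

(* Sq^n [a] = [a u_(q - n) a] for a cocycle a of degree q, and 0 for n > q. *)
Definition sq_cochain n q (a : cochain q) : cochain (q + n) :=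
  if (n <= q)%N then cup (q - n) (q + n) a a else 0.

Arguments sq_cochain n {q} a _.

Lemma sq_cocycle_subproof n q (a : cocycle q) : sq_cochain n a \in @is_cocycle (q + n).
Proof.
have /eqP da := cocycleP a.
rewrite inE /sq_cochain; case: ifP => _; last by rewrite coboundary0.
case: (q - n)%N => [|i].
  by rewrite coboundary_cup0 da cup0l cup0r addr0.
by rewrite coboundary_cup da cup0l cup0r !add0r cochain_addrr.
Qed.

Definition sq_cocycle n q (a : cocycle q) : cocycle (q + n) :=
  Cocycle (sq_cocycle_subproof n a).
Arguments sq_cocycle n {q} a.

Definition Sq n q (x : cohomology q) : cohomology (q + n) :=
  \pi_(cohomology (q + n))%qT (sq_cocycle n (repr x)).
Arguments Sq n {q} x.

Lemma cup_exact i q N (b : cochain q) :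
  exists c : cochain N, cup i N.+1 (coboundary b) (coboundary b) = coboundary c.
Proof.
case: i => [|i].
  by exists (cup 0 N b (coboundary b)); rewrite coboundary_cup0 coboundaryK cup0r addr0.
exists (cup i.+1 N b (coboundary b) + cup i N b b).
rewrite coboundaryD coboundary_cup coboundaryK cup0r addr0 -addrA; apply/esym.
rewrite -[RHS]addr0; congr (_ + _).
suff -> : coboundary (cup i N b b) =
    cup i N.+1 b (coboundary b) + cup i N.+1 (coboundary b) b by exact: cochain_addrr.
case: i => [|i]; first by rewrite coboundary_cup0 addrC.
by rewrite coboundary_cup cochain_addrr addr0 addrC.
Qed.

Lemma cup_comm i p q N (a : cochain p) (b : cochain q) :
  coboundary a = 0 -> coboundary b = 0 ->
  cup i N.+1 a b + cup i N.+1 b a = coboundary (cup i.+1 N a b).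
Proof. by move=> da db; rewrite coboundary_cup da db cup0l cup0r !add0r. Qed.

Lemma sq_cochain_exact n q (a : cochain q.+1) (b : cochain q) : coboundary a = 0 ->
  exists c : cochain (q + n),
    sq_cochain n (a + coboundary b) = sq_cochain n a + coboundary c.
Proof.
move=> da; rewrite /sq_cochain; case: ifP => _; last first.
  by exists 0; rewrite coboundary0 addr0.
have [c cE] := cup_exact (q.+1 - n) (q + n) b.
exists (cup (q.+1 - n).+1 (q + n) a (coboundary b) + c).
rewrite coboundaryD -cE -cup_comm ?coboundaryK // cupDl !cupDr.
by rewrite -!addrA.
Qed.

(* Sq does not depend on the chosen representative. *)
Lemma Sq_pi n q (a : cocycle q) :
  Sq n (\pi_(cohomology q)%qT a) = \pi_(cohomology (q + n))%qT (sq_cocycle n a).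
Proof.
rewrite /Sq; set b := repr _.
have : b == a %[mod cohomology q]%qT by rewrite /b reprK.
rewrite -Quotient.idealrBE => /asboolP ab; apply/eqP.
rewrite -Quotient.idealrBE; apply/asboolP.
have da := eqP (cocycleP a).
have bE : cocycle_val b = cocycle_val a + (cocycle_val b - cocycle_val a).
  by rewrite addrC subrK.
rewrite -[cocycle_val (b - a)]/(cocycle_val b - cocycle_val a) in ab.
rewrite -[cocycle_val (_ - _)]/(sq_cochain n b - sq_cochain n a) bE.
move: (cocycle_val a) (cocycle_val b - cocycle_val a) ab da => {bE a b}.
case: q => [|q] a e /=.
  move=> -> _; rewrite addr0 subrr; case: n => // n; exists 0; by rewrite coboundary0.
move=> [b ->] da; have [c ->] := sq_cochain_exact n b da.
by exists c; rewrite addrC addKr.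
Qed.

End Singular.

Definition sq_nontrivial (R : realType) (T : topologicalType) (n : nat) : Prop :=
  exists (q : nat) (x : cohomology R T q), Sq n x != 0.

Definition realization (R : realType) (V : finType) (K : simplicial_complex V) :
    set {ptws V -> R} :=
  [set x | [/\ forall v, 0 <= x v, \sum_v x v = 1 &
               [set v | x v != 0]%SET \in faces K]].

Arguments realization R {V} K.

Definition polyhedral_product (T : topologicalType) (X A : set T) (V : finType)
    (M : simplicial_complex V) : set {ptws V -> T} :=
  [set z | exists2 s : {set V}, s \in faces M & forall v, (if v \in s then X else A) (z v)].

Definition disk (R : realType) : set (R * R)%type := [set p | p.1 ^+ 2 + p.2 ^+ 2 <= 1].

Definition circle (R : realType) : set (R * R)%type := [set p | p.1 ^+ 2 + p.2 ^+ 2 = 1].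

Definition moment_angle (R : realType) (V : finType) (M : simplicial_complex V) :
    set {ptws V -> (R * R)%type} :=
  polyhedral_product (@disk R) (@circle R) M.
Arguments moment_angle R {V} M.

(* Main.v *)
(* Write Z for the moment-angle complex of a complex M on V, and |M| for its
   realization. Restriction of coordinates makes Z a retract of the moment-angle
   complex over any complex containing M as a full subcomplex; K and the K_i are
   full subcomplexes of the substitution complex, so it suffices to pass from |M|
   to Z.

   Let C be the part of Z where no coordinate is 1, and F the union of the parts
   F_v where the v-th coordinate is not -1. The Cayley transform identifies the
   intersection of C and F with the punctured product of the cone over M and
   R^V, which is an iterated suspension of |M|. The set C is contractible, by
   hyperbolic translations of the disks towards -1. The set F is not, but the
   retraction e_v of Z replacing the v-th coordinate by 1 has image in F_v and is
   homotopic to the identity on F_v, so the product of the operators 1 + e_v^*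
   kills the cohomology of F, while it fixes every cocycle of Z that vanishes
   on F. A Mayer-Vietoris argument then carries a nonzero square on the
   intersection to a nonzero square on Z; the same argument with two contractible
   pieces gives each suspension step. The only input about singular cochains is
   the theorem on small simplices, proved by iterated barycentric subdivision. *)
Require Import Defs.
From HB Require Import structures.
From mathcomp Require Import all_boot all_order all_algebra zify ring lra.
From mathcomp Require Import all_classical all_reals topology normedtype sequences.
Import numFieldNormedType.Exports.
Set Implicit Arguments.
Unset Strict Implicit.
Unset Printing Implicit Defensive.
Import Order.TTheory GRing.Theory Num.Theory.
Local Open Scope classical_set_scope.
Local Open Scope ring_scope.

Lemma F2_two : 2%:R = 0 :> 'F_2.
Proof. exact/eqP. Qed.

(** * Cochains on sequences of vertices *)

Section SequenceFunctionals.
Variable P : Type.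
Implicit Types (f g : seq P -> 'F_2) (s t : seq P) (H : pred P).

(** The simplicial coboundary of [f] at [s], mod 2. Recursion on the first vertex makes the boundary
    formula of a cone hold by computation. *)
Fixpoint bd f s : 'F_2 :=
  if s is v :: s' then f s' + bd (fun t => f (v :: t)) s' else 0.

Lemma bd_eq H f g s : all H s ->
  (forall t, all H t -> (size t).+1 = size s -> f t = g t) -> bd f s = bd g s.
Proof.
elim: s f g => //= v s IH f g /andP[Hv Hs] fg.
rewrite fg // (IH _ (fun t => g (v :: t))) // => t Ht st.
by rewrite fg /= ?Hv ?Ht ?st.
Qed.

Lemma bd_eq_size f g s :
  (forall t, (size t).+1 = size s -> f t = g t) -> bd f s = bd g s.
Proof. by move=> fg; apply: (@bd_eq predT) => [|t _]; [exact: all_predT|exact: fg]. Qed.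

Lemma bd0 s : bd (fun=> 0) s = 0.
Proof. by elim: s => //= v s ->; rewrite addr0. Qed.

Lemma bdD f g s : bd (fun t => f t + g t) s = bd f s + bd g s.
Proof. by elim: s f g => [|v s IH] f g /=; rewrite ?addr0 // IH addrACA. Qed.

Lemma bd_sum (I : Type) (r : seq I) (F : I -> seq P -> 'F_2) s :
  bd (fun t => \sum_(i <- r) F i t) s = \sum_(i <- r) bd (F i) s.
Proof.
elim: r => [|i r IH].
  by rewrite big_nil (bd_eq_size (g := fun=> 0)) ?bd0 // => t _; rewrite big_nil.
rewrite big_cons -IH -bdD; apply: bd_eq_size => t _; by rewrite big_cons.
Qed.

Lemma bdK f s : bd (bd f) s = 0.
Proof.
elim: s f => //= v s IH f.
by rewrite bdD IH addr0 F2_addrr.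
Qed.

Lemma bdE f s :
  bd f s = \sum_(i < size s) f (take i s ++ drop i.+1 s).
Proof.
elim: s f => [|v s IH] f /=; first by rewrite big_ord0.
by rewrite big_ord_recl /= drop0 IH.
Qed.

Section Subdivision.
(* [b s] stands for the barycentre of [s]. *)
Variable b : seq P -> P.

(** Transpose of the subdivision operator, which sends a simplex to the cone from its barycentre
    over its subdivided boundary. The recursion argument [n] is meant to be [size s]. *)
Fixpoint subdiv n f s : 'F_2 :=
  if n is m.+1 then bd (subdiv m (fun t => f (b s :: t))) s else f s.

(** Transpose of the chain homotopy from the identity to subdivision: the cone from the barycentre
    over the simplex plus the homotopy applied to its boundary. *)
Fixpoint subdivT n f s : 'F_2 :=
  if n is m.+1 then f (b s :: s) + bd (subdivT m (fun t => f (b s :: t))) s else 0.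

Lemma subdiv_eq n f g s : size s = n ->
  (forall t, size t = n -> f t = g t) -> subdiv n f s = subdiv n g s.
Proof.
elim: n f g s => [|n IH] f g s sn fg /=; first exact: fg.
apply: bd_eq_size => t; rewrite sn => -[tn]; apply: IH => // u un.
by apply: fg; rewrite /= un.
Qed.

Lemma subdivT_eq n f g s : size s = n ->
  (forall t, size t = n.+1 -> f t = g t) -> subdivT n f s = subdivT n g s.
Proof.
elim: n f g s => [|n IH] f g s sn fg //=.
rewrite fg /= ?sn //; congr (_ + _).
apply: bd_eq_size => t; rewrite sn => -[tn]; apply: IH => // u un.
by apply: fg; rewrite /= un.
Qed.

Lemma subdiv0 n s : subdiv n (fun=> 0) s = 0.
Proof.
elim: n s => //= n IH s; rewrite -[RHS](bd0 s); apply: bd_eq_size => t _; exact: IH.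
Qed.

Lemma subdivT0 n s : subdivT n (fun=> 0) s = 0.
Proof.
elim: n s => //= n IH s; rewrite add0r -[RHS](bd0 s); apply: bd_eq_size => t _; exact: IH.
Qed.

Lemma subdivD n f g s :
  subdiv n (fun t => f t + g t) s = subdiv n f s + subdiv n g s.
Proof.
elim: n f g s => //= n IH f g s; rewrite -bdD.
by apply: bd_eq_size => t _; exact: IH.
Qed.

Lemma subdivTD n f g s :
  subdivT n (fun t => f t + g t) s = subdivT n f s + subdivT n g s.
Proof.
elim: n f g s => [|n IH] f g s /=; first by rewrite addr0.
rewrite addrACA -bdD; congr (_ + _).
by apply: bd_eq_size => t _; exact: IH.
Qed.

(** The boundary of a cone is its base plus the cone over the boundary of the base; here the base
    comes from a boundary, so the second part vanishes by [bdK]. *)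
Lemma subdiv_bd n f s : size s = n.+1 -> subdiv n.+1 (bd f) s = bd (subdiv n f) s.
Proof.
elim: n f s => [|n IH] f s sn.
  by case: s sn => [|v []] //= _; rewrite !addr0.
rewrite [LHS]/= -[RHS]addr0 -(bdK (subdiv n (fun t => f (b s :: t))) s) -bdD.
apply: bd_eq_size => t; rewrite sn => -[tn].
rewrite -[LHS]/(subdiv n.+1 (fun t0 => f t0 + bd (fun u => f (b s :: u)) t0) t).
by rewrite subdivD IH.
Qed.

Lemma subdivT_bd n f s : size s = n.+1 ->
  subdivT n.+1 (bd f) s + bd (subdivT n f) s = f s + subdiv n.+1 f s.
Proof.
elim: n f s => [|n IH] f s sn.
  by case: s sn => [|v [|w s]] // _; rewrite /= !addr0.
rewrite -[subdivT n.+2 _ _]/((bd f (b s :: s)) + bd (subdivT n.+1 (fun t => bd f (b s :: t))) s).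
rewrite -[bd f (b s :: s)]/(f s + bd (fun t => f (b s :: t)) s).
have -> : bd (subdivT n.+1 (fun t => bd f (b s :: t))) s =
   bd (fun t => subdivT n.+1 f t + (f (b s :: t) + subdiv n.+1 (fun u => f (b s :: u)) t
        + bd (subdivT n (fun u => f (b s :: u))) t)) s.
  apply: bd_eq_size => t; rewrite sn => -[tn].
  rewrite -[LHS]/(subdivT n.+1 (fun t0 => f t0 + bd (fun u => f (b s :: u)) t0) t).
  by rewrite subdivTD (F2_move (IH _ _ tn)) [bd _ t + _]addrC.
rewrite !bdD bdK -[subdiv n.+2 f s]/(bd (subdiv n.+1 (fun t => f (b s :: t))) s).
ring: F2_two.
Qed.

End Subdivision.

End SequenceFunctionals.

Lemma bd_map (P Q : Type) (L : P -> Q) (f : seq Q -> 'F_2) s :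
  bd f (map L s) = bd (fun t => f (map L t)) s.
Proof. by elim: s f => //= v s IH f; rewrite IH. Qed.

(** Deleting the [v]-th vertex of the full ordered list amounts to applying [lift v] to the shorter
    one; this ties [bd] to the singular coboundary. *)
Lemma bd_enum n (f : seq 'I_n.+1 -> 'F_2) :
  bd f (enum 'I_n.+1) = \sum_(v < n.+1) f (map (lift v) (enum 'I_n)).
Proof.
rewrite bdE size_enum_ord; apply: eq_bigr => v _; congr f.
apply: (inj_map val_inj); rewrite map_cat map_take map_drop val_enum_ord -map_comp.
have vn : (v <= n)%N by rewrite -ltnS.
rewrite -[RHS]/(map (bump v \o val) (enum 'I_n)) (map_comp (bump v) val) val_enum_ord.
have tv : size (take v (iota 0 n.+1)) = v by rewrite size_take size_iota ltn_ord.
apply: (@eq_from_nth _ 0%N) => [|i].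
  by rewrite size_map size_cat tv size_drop !size_iota; lia.
rewrite size_cat tv size_drop size_iota => iq.
rewrite (nth_map 0%N) ?size_iota; last by lia.
rewrite nth_cat tv nth_iota /bump; last by lia.
case: (ltnP i v) => iv; first by rewrite nth_take // nth_iota //; lia.
by rewrite nth_drop nth_iota; lia.
Qed.

Section SubdivisionNaturality.
Variables (P Q : Type) (b : seq P -> P) (b' : seq Q -> Q) (L : P -> Q).
Hypothesis Lb : forall s, (0 < size s)%N -> L (b s) = b' (map L s).

Lemma subdiv_map n (f : seq Q -> 'F_2) s : size s = n ->
  subdiv b' n f (map L s) = subdiv b n (fun t => f (map L t)) s.
Proof.
elim: n f s => //= n IH f s sn; rewrite bd_map -Lb ?sn //.
by apply: bd_eq_size => t; rewrite sn => -[tn]; rewrite IH.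
Qed.

Lemma subdivT_map n (f : seq Q -> 'F_2) s : size s = n ->
  subdivT b' n f (map L s) = subdivT b n (fun t => f (map L t)) s.
Proof.
elim: n f s => //= n IH f s sn; rewrite bd_map -Lb ?sn //; congr (_ + _).
by apply: bd_eq_size => t; rewrite sn => -[tn]; rewrite IH.
Qed.

End SubdivisionNaturality.

(** * The prism operator *)

Section Prism.
Variables (P Q : Type) (bot top : P -> Q).

(** Transpose of the classical prism operator: bottom vertices up to the [i]-th, then top vertices
    from the [i]-th on, summed over [i]. *)
Fixpoint prism (f : seq Q -> 'F_2) (s : seq P) : 'F_2 :=
  if s is v :: s' then
    f (bot v :: map top (v :: s')) + prism (fun t => f (bot v :: t)) s'
  else 0.

Lemma prismD f g s : prism (fun t => f t + g t) s = prism f s + prism g s.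
Proof. by elim: s f g => [|v s IH] f g /=; rewrite ?addr0 // IH addrACA. Qed.

Lemma prism_eq f g s : (forall t, size t = (size s).+1 -> f t = g t) ->
  prism f s = prism g s.
Proof.
elim: s f g => //= v s IH f g fg; rewrite fg /= ?size_map //; congr (_ + _).
by apply: IH => t ts; apply: fg; rewrite /= ts.
Qed.

Lemma prism0 s : prism (fun=> 0) s = 0.
Proof. by elim: s => //= v s ->; rewrite addr0. Qed.

(** Mod 2 the interior faces cancel in pairs, leaving the two ends and the prism over the
    boundary. *)
Lemma prism_bd f s :
  prism (bd f) s + bd (prism f) s = f (map top s) + f (map bot s).
Proof.
elim: s f => [|v s IH] f /=; first by rewrite addr0 F2_addrr.
set fb := fun t => f (bot v :: t).
have -> : prism (fun t => f t + bd fb t) s = prism f s + prism (bd fb) s by exact: prismD.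
have -> : bd (fun t => f (bot v :: top v :: map top t) + prism fb t) s =
   bd (fun t => fb (top v :: map top t)) s + bd (prism fb) s by exact: bdD.
have {}IH : prism (bd fb) s = bd (prism fb) s + (fb (map top s) + fb (map bot s)).
  by rewrite -IH [RHS]addrC -addrA F2_addrr addr0.
rewrite IH bd_map -[f (bot v :: map bot s)]/(fb (map bot s)) -[f (bot v :: map top s)]/(fb (map top s)).
ring: F2_two.
Qed.

End Prism.

Lemma prism_map (P P' Q Q' : Type) (bot top : P -> Q) (bot' top' : P' -> Q')
    (L : P' -> P) (M : Q' -> Q) (f : seq Q -> 'F_2) s :
  (forall v, bot (L v) = M (bot' v)) -> (forall v, top (L v) = M (top' v)) ->
  prism bot top f (map L s) = prism bot' top' (fun t => f (map M t)) s.
Proof.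
move=> Lbot Ltop; elim: s f => //= v s IH f; rewrite IH Lbot Ltop -!map_comp.
by rewrite (eq_map Ltop).
Qed.

Arguments simplex_map {R p q} f x.
Notation stdsimplex R n := (set_type (@std_simplex R n)).

(** * Evaluating cochains on maps *)

Section Evaluation.
Variables (R : realType) (T : topologicalType).

(** Extension by zero to maps that may fail to be continuous, so that a composite can be fed to a
    cochain before its continuity is known. *)
Definition ev q (phi : cochain R T q) (f : stdsimplex R q -> T) : 'F_2 :=
  if pselect (continuous f) is left cf then phi (mkcts cf) else 0.

Lemma evE q (phi : cochain R T q) (f : stdsimplex R q -> T) (s : sing R T q) :
  f =1 s -> ev phi f = phi s.
Proof.
move=> fs; have {fs} -> : f = s by apply/funext.
rewrite /ev; case: pselect => [cf|[]]; last exact: cts_fun.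
by congr phi; apply/continuousEP.
Qed.

Lemma ev_eq0 q (phi : cochain R T q) (f : stdsimplex R q -> T) :
  (forall s : sing R T q, f =1 s -> phi s = 0) -> ev phi f = 0.
Proof. by move=> f0; rewrite /ev; case: pselect => // cf; apply: f0. Qed.

Lemma ev_coboundary q (phi : cochain R T q) (f : stdsimplex R q.+1 -> T) :
  continuous f ->
  ev (coboundary phi) f = \sum_(v < q.+2) ev phi (f \o simplex_map (lift v)).
Proof.
move=> cf; rewrite (evE _ (s := mkcts cf)) // /coboundary.
by apply: eq_bigr => v _; rewrite (evE _ (s := sing_map (lift v) (mkcts cf))).
Qed.

(* A coherent family of affine simplices with vertices in [P], together with its
   realisation in [T]. *)
Variables (P : Type) (x0 : P).
Variable rho : forall k, ('I_k.+1 -> P) -> stdsimplex R k -> T.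
Hypothesis rho_map : forall p q (f : 'I_p.+1 -> 'I_q.+1) (w : 'I_q.+1 -> P),
  rho (w \o f) =1 rho w \o simplex_map f.

Definition ev_seq q (phi : cochain R T q) (s : seq P) : 'F_2 :=
  ev phi (rho (fun i : 'I_q.+1 => nth x0 s i)).

Lemma ev_seq_coboundary q (phi : cochain R T q) s : size s = q.+2 ->
  continuous (rho (fun i : 'I_q.+2 => nth x0 s i)) ->
  ev_seq (coboundary phi) s = bd (ev_seq phi) s.
Proof.
move=> ss cs; rewrite /ev_seq ev_coboundary // bdE ss; apply: eq_bigr => v _.
congr ev; rewrite -(funext (rho_map _ _)); congr rho; apply/funext => i /=.
have vs : (v < size s)%N by rewrite ss.
rewrite nth_cat size_take vs /bump; case: (ltnP i v) => iv.
  by rewrite nth_take.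
by rewrite nth_drop; congr nth; lia.
Qed.

End Evaluation.

(** * Affine simplices and barycentric subdivision *)

Section Affine.
Variable R : realType.
Local Notation Delta n := (stdsimplex R n).

Lemma simplex_ge0 n (x : Delta n) i : 0 <= set_val x i.
Proof. by have [x0 _] := set_valP x; exact: x0. Qed.

Lemma simplex_sum1 n (x : Delta n) : \sum_i set_val x i = 1.
Proof. by have [_ x1] := set_valP x. Qed.

Lemma simplex_le1 n (x : Delta n) i : set_val x i <= 1.
Proof.
rewrite -(simplex_sum1 x) (bigD1 i) //= lerDl sumr_ge0 // => j _.
exact: simplex_ge0.
Qed.

Lemma simplex_coord_continuous n i : continuous (fun x : Delta n => set_val x i : R).
Proof.
move=> x; apply: (@continuous_comp _ _ _ set_val (fun g : {ptws 'I_n.+1 -> R} => g i)).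
  exact: initial_continuous.
exact: proj_continuous.
Qed.

Lemma continuous_simplex (X : topologicalType) n (f : X -> Delta n) :
  (forall j, continuous (fun x => set_val (f x) j : R)) -> continuous f.
Proof. by move=> cf; apply: continuous_comp_initial; apply: continuous_ptws. Qed.

Lemma affine_subproof k p (w : 'I_k.+1 -> Delta p) (x : Delta k) :
  ((fun j => \sum_i set_val x i * set_val (w i) j) : {ptws 'I_p.+1 -> R})
    \in @std_simplex R p.
Proof.
rewrite inE; split=> [j|].
  by apply: sumr_ge0 => i _; rewrite mulr_ge0 ?simplex_ge0.
rewrite exchange_big -[RHS](simplex_sum1 x); apply: eq_bigr => i _.
by rewrite -mulr_sumr simplex_sum1 mulr1.
Qed.

Definition affine k p (w : 'I_k.+1 -> Delta p) (x : Delta k) : Delta p :=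
  SigSub (affine_subproof w x).

Lemma affineE k p (w : 'I_k.+1 -> Delta p) (x : Delta k) j :
  set_val (affine w x) j = \sum_i set_val x i * set_val (w i) j.
Proof. by []. Qed.

Lemma affine_continuous k p (w : 'I_k.+1 -> Delta p) : continuous (affine w).
Proof.
apply: continuous_simplex => j; apply: continuous_sum => i x.
apply: continuousM; first exact: (@simplex_coord_continuous k i x). apply: cst_continuous.
Qed.

Lemma affine_map p q r (f : 'I_p.+1 -> 'I_q.+1) (w : 'I_q.+1 -> Delta r) x :
  affine (w \o f) x = affine w (simplex_map f x).
Proof.
apply: val_inj; apply/funext => j /=; rewrite /push.
rewrite (partition_big f predT) //=; apply: eq_bigr => k _.
by rewrite mulr_suml; apply: eq_bigr => i /eqP <-.
Qed.

Lemma affine_comp k p q (v : 'I_k.+1 -> Delta p) (w : 'I_p.+1 -> Delta q) x :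
  affine w (affine v x) = affine (fun i => affine w (v i)) x.
Proof.
apply: val_inj; apply/funext => j /=.
under eq_bigr do rewrite mulr_suml.
rewrite exchange_big; apply: eq_bigr => i _ /=.
by rewrite mulr_sumr; apply: eq_bigr => l _; rewrite mulrA.
Qed.

Lemma vertex_subproof n (k : 'I_n.+1) :
  ((fun j => (k == j)%:R) : {ptws 'I_n.+1 -> R}) \in @std_simplex R n.
Proof.
rewrite inE; split=> [j|]; first exact: ler0n.
by rewrite (bigD1 k) //= eqxx big1 ?addr0 // => j /negPf; rewrite eq_sym => ->.
Qed.

Definition vertex n (k : 'I_n.+1) : Delta n := SigSub (vertex_subproof k).

Lemma vertexE n (k j : 'I_n.+1) : set_val (vertex k) j = (k == j)%:R.
Proof. by []. Qed.

Lemma affine_vertex k p (w : 'I_k.+1 -> Delta p) i : affine w (vertex i) = w i.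
Proof.
apply: val_inj; apply/funext => j /=.
rewrite (bigD1 i) //= vertexE eqxx mul1r big1 ?addr0 // => l /negPf il.
by rewrite vertexE eq_sym il mul0r.
Qed.

Lemma affine_vertices n (x : Delta n) : affine (@vertex n) x = x.
Proof.
apply: val_inj; apply/funext => j /=.
rewrite (bigD1 j) //= vertexE eqxx mulr1 big1 ?addr0 // => l /negPf jl.
by rewrite vertexE jl mulr0.
Qed.

Definition vertices n : seq (Delta n) := [seq vertex k | k <- enum 'I_n.+1].

Lemma size_vertices n : size (vertices n) = n.+1.
Proof. by rewrite size_map size_enum_ord. Qed.

Lemma nth_vertices n x0 (i : 'I_n.+1) : nth x0 (vertices n) i = vertex i.
Proof.
by rewrite (nth_map i) ?size_enum_ord // nth_ord_enum.
Qed.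

Definition vertex0 n : Delta n := vertex ord0.

Lemma bary_subproof n (s : seq (Delta n)) : (0 < size s)%N ->
  ((fun j => (size s)%:R^-1 * \sum_(y <- s) set_val y j) : {ptws 'I_n.+1 -> R})
    \in @std_simplex R n.
Proof.
move=> s0; rewrite inE; split=> [j|].
  by rewrite mulr_ge0 ?invr_ge0 // sumr_ge0 // => y _; exact: simplex_ge0.
rewrite -mulr_sumr exchange_big /=.
under eq_bigr do rewrite simplex_sum1.
by rewrite big_const_seq count_predT iter_addr_0 mulVf // pnatr_eq0 -lt0n.
Qed.

(** The empty list has no barycentre and gets the arbitrary value [vertex0]. *)
Definition bary n (s : seq (Delta n)) : Delta n :=
  if pselect (0 < size s)%N is left s0 then SigSub (bary_subproof s0) else vertex0 n.

Lemma baryE n (s : seq (Delta n)) j : (0 < size s)%N ->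
  set_val (bary s) j = (size s)%:R^-1 * \sum_(y <- s) set_val y j.
Proof. by rewrite /bary; case: pselect. Qed.

Lemma affine_bary k p (w : 'I_k.+1 -> Delta p) s : (0 < size s)%N ->
  affine w (bary s) = bary (map (affine w) s).
Proof.
move=> s0; apply: val_inj; apply/funext => j; rewrite -[LHS]/(set_val _ _) -[RHS]/(set_val _ _).
rewrite affineE [RHS]baryE ?size_map // big_map.
rewrite (eq_bigr (fun i => (size s)%:R^-1 * ((\sum_(y <- s) set_val y i) * set_val (w i) j))); last first.
  by move=> i _; rewrite baryE // mulrA.
rewrite -mulr_sumr; congr (_ * _).
under [LHS]eq_bigr do rewrite mulr_suml.
by rewrite exchange_big.
Qed.

End Affine.
Arguments bary {R n} s.
Arguments vertex0 {R n}.
Arguments vertices {R} n.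

(** * Barycentric subdivision shrinks simplices *)

Section Shrinking.
Variables (R : realType) (p : nat).
Local Notation Delta := (stdsimplex R p).

Definition near_pt (eps : R) (x y : Delta) := forall j, `|set_val x j - set_val y j| <= eps.

Definition small (eps : R) (s : seq Delta) := forall x y, x \in s -> y \in s -> near_pt eps x y.

Definition bary_closed (H : pred Delta) :=
  forall s, (0 < size s)%N -> all H s -> H (bary s).

Lemma near_pt_sym eps x y : near_pt eps x y -> near_pt eps y x.
Proof. by move=> xy j; rewrite distrC. Qed.

Lemma near_bary_closed eps x : bary_closed (fun y => `[< near_pt eps x y >]).
Proof.
move=> s s0 /allP Hs; apply/asboolP => j; rewrite baryE //.
have n0 : (size s)%:R != 0 :> R by rewrite pnatr_eq0 -lt0n.
have -> : set_val x j = (size s)%:R^-1 * \sum_(y <- s) set_val x j.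
  by rewrite big_const_seq count_predT iter_addr_0 -[X in _ * X]mulr_natl mulKf.
rewrite -mulrBr -sumrB normrM ger0_norm ?invr_ge0 // ler_pdivrMl ?ltr0n //.
apply: (le_trans (ler_norm_sum _ _ _)).
rewrite mulr_natl; apply: (@le_trans _ _ (\sum_(y <- s) eps)).
  by rewrite big_seq [leRHS]big_seq; apply: ler_sum => y /Hs /asboolP.
by rewrite big_const_seq count_predT iter_addr_0.
Qed.

Variable N : nat.
(** The classical contraction factor for simplices with at most [N.+1] vertices. *)
Definition kappa : R := N%:R / N.+1%:R.

Lemma kappa_ge0 : 0 <= kappa. Proof. by rewrite divr_ge0. Qed.

(** In the average of the differences between [x] and the points of [s], the term of [x] itself is
    zero, so at most [size s - 1] of the [size s] terms contribute. *)
Lemma near_bary eps s x : (size s <= N.+1)%N -> small eps s -> x \in s ->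
  near_pt (kappa * eps) (bary s) x.
Proof.
move=> sN ss xs j.
have s0 : (0 < size s)%N by case: s xs {sN ss}.
have eps0 : 0 <= eps by apply: le_trans (ss x x xs xs j).
rewrite baryE //; have n0 : (size s)%:R != 0 :> R by rewrite pnatr_eq0 -lt0n.
have -> : set_val x j = (size s)%:R^-1 * \sum_(y <- s) set_val x j.
  by rewrite big_const_seq count_predT iter_addr_0 -[X in _ * X]mulr_natl mulKf.
rewrite -mulrBr -sumrB normrM ger0_norm ?invr_ge0 // ler_pdivrMl ?ltr0n //.
apply: (le_trans (ler_norm_sum _ _ _)).
rewrite (big_rem x) //= subrr normr0 add0r.
apply: (@le_trans _ _ (\sum_(y <- rem x s) eps)).
  rewrite big_seq [leRHS]big_seq; apply: ler_sum => y /mem_rem ys.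
  exact: ss.
rewrite big_const_seq count_predT iter_addr_0 size_rem // -[leLHS]mulr_natl mulrA ler_wpM2r //.
rewrite /kappa mulrA ler_pdivlMr ?ltr0Sn // -!natrM ler_nat.
by case: (size s) s0 sN => // n _ /=; lia.
Qed.

(** The predicate [H] carries constraints on the vertices through the recursion. Each step adds
    nearness to the barycentre just coned off; this condition is closed under barycentres, so later
    ones stay near it. *)
Lemma subdiv_small n (H : pred Delta) eps (f : seq Delta -> 'F_2) s :
  bary_closed H -> all H s -> size s = n -> (n <= N.+1)%N -> small eps s ->
  (forall t, all H t -> size t = n -> small (kappa * eps) t -> f t = 0) ->
  subdiv bary n f s = 0.
Proof.
elim: n H f s => [|n IH] H f s Hb Hs sn nN ss f0 /=.
  by apply: f0 => //; case: s sn {ss Hs} => //= _ x y; rewrite in_nil.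
have eps0 : 0 <= eps.
  case: s sn ss {Hs} => // z s _ ss.
  exact: le_trans (ss z z (mem_head _ _) (mem_head _ _) ord0).
pose H' := fun y => H y && `[< near_pt (kappa * eps) (bary s) y >].
have H'b : bary_closed H'.
  move=> t t0 /allP tH'; apply/andP; split.
    by apply: Hb => //; apply/allP => y /tH' /andP[].
  by apply: near_bary_closed => //; apply/allP => y /tH' /andP[].
have H's : all (fun y => H' y && (y \in s)) s.
  apply/allP => y ys; rewrite ys andbT; apply/andP; split; first exact: (allP Hs).
  by apply/asboolP; apply: near_bary => //; rewrite sn.
rewrite -[RHS](bd0 s).
apply: (bd_eq H's) => t Ht st.
have tn : size t = n by move: st; rewrite sn => -[].
apply: (IH H') => //.
- by apply: sub_all Ht => y /andP[].
- exact: ltnW.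
- by move=> x y xt yt; apply: ss; [have /andP[] := allP Ht _ xt | have /andP[] := allP Ht _ yt].
move=> u /allP Hu un su; apply: f0; rewrite /= ?un //.
  rewrite Hb ?sn //=; by apply/allP => y /Hu /andP[].
have bu y : y \in u -> near_pt (kappa * eps) (bary s) y.
  by move=> /Hu /andP[_ /asboolP].
move=> x y; rewrite !inE => /predU1P[->|xu] /predU1P[->|yu].
- by move=> j; rewrite subrr normr0 mulr_ge0 ?kappa_ge0.
- exact: bu.
- exact/near_pt_sym/bu.
- exact: su.
Qed.

Definition sd (f : seq Delta -> 'F_2) s := subdiv bary (size s) f s.

Lemma iter_sd_small k n eps (f : seq Delta -> 'F_2) s :
  size s = n -> (n <= N.+1)%N -> small eps s ->
  (forall t, size t = n -> small (kappa ^+ k * eps) t -> f t = 0) ->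
  iter k sd f s = 0.
Proof.
elim: k eps s => [|k IH] eps s sn nN ss f0 /=.
  by apply: f0 => //; rewrite expr0 mul1r.
rewrite /sd; apply: (@subdiv_small _ predT eps); rewrite ?all_predT ?sn //.
move=> t _ tn st; apply: (IH (kappa * eps)) => // u un su.
by apply: f0 => //; rewrite exprSr -mulrA.
Qed.

Lemma small1 (s : seq Delta) : small 1 s.
Proof.
move=> x y _ _ j; have := simplex_ge0 x j; have := simplex_ge0 y j.
have := simplex_le1 x j; have := simplex_le1 y j => *.
by rewrite ler_norml; apply/andP; split; lra.
Qed.

Lemma kappa_small (eps : R) : 0 < eps -> exists m, forall k, (m <= k)%N -> kappa ^+ k <= eps.
Proof.
move=> e0; have k1 : `|kappa| < 1.
  by rewrite ger0_norm ?kappa_ge0 // ltr_pdivrMr ?ltr0Sn // mul1r ltr_nat.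
have := cvg_expr k1 => /cvgrPdist_le /(_ eps e0) [m _ mP].
exists m => k mk; have := mP k mk; rewrite /= sub0r normrN ger0_norm //.
exact/exprn_ge0/kappa_ge0.
Qed.

End Shrinking.

(** * Compactness and Lebesgue numbers *)

Lemma cvg_initial (S : choiceType) (U : topologicalType) (f : S -> U)
    (F : set_system S) (x : S) : Filter F ->
  f @ F --> f x -> F --> (x : initial_topology f).
Proof.
move=> FF fF A; rewrite /= nbhsE => -[B [[C oC <-] Cx] BA].
by apply: filterS BA _; apply: (fF C); exact: open_nbhs_nbhs.
Qed.

Lemma near_dist_le (R : realType) (X : topologicalType) (I : finType) (f : I -> X -> R) x d :
  (forall i, continuous (f i)) -> 0 < d ->
  \forall y \near x, forall i, `|f i x - f i y| <= d.
Proof.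
move=> cf d0; apply: filter_forall => i.
by have /cvgrPdist_le := cf i x; apply.
Qed.

Section Lebesgue.
Variables (R : realType) (p : nat).
Local Notation Delta := (stdsimplex R p).

(** The simplex has the initial topology of its coordinates, so the filter of coordinatewise balls
    around [x] converges to [x]. *)
Lemma nbhs_near_pt (x : Delta) (A : set Delta) : nbhs x A ->
  exists2 d, 0 < d & forall y, near_pt d x y -> A y.
Proof.
pose F : set_system Delta := filter_from [set d : R | 0 < d] (fun e => [set y | near_pt e y x]).
have FF : Filter F.
  apply: filter_from_filter; first by exists 1; rewrite /= ltr01.
  move=> d e /= d0 e0; exists (Num.min d e); first by rewrite lt_min d0.
  by move=> y yx; split=> j; have := yx j; rewrite le_min => /andP[].
suff cF : F --> x.
  by move=> /cF [d /= d0 dA]; exists d => // y xy; apply: dA; exact: near_pt_sym.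
apply: cvg_initial; apply/cvg_sup => j; apply: cvg_initial.
apply/cvgrPdist_le => e e0 /=; exists e => // y yx.
by rewrite /= distrC; exact: yx.
Qed.

Lemma compact_std_simplex : compact (@std_simplex R p).
Proof.
have cube : compact [set x : {ptws 'I_p.+1 -> R} | forall i, `[0, 1]%classic (x i)].
  apply: (@tychonoff _ (fun _ : 'I_p.+1 => R) (fun=> `[0, 1]%classic)) => i.
  exact: segment_compact.
have coordC i : continuous (fun x : {ptws 'I_p.+1 -> R} => x i : R).
  by move=> x; exact: proj_continuous.
apply: (subclosed_compact _ cube); last first.
  move=> x xs i; rewrite /= in_itv /=.
  have xD : x \in @std_simplex R p by rewrite inE.
  have := simplex_ge0 (SigSub xD) i; have := simplex_le1 (SigSub xD) i.
  by rewrite /= => -> ->.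
have -> : @std_simplex R p =
    (\bigcap_i ((fun x => x i) @^-1` [set r : R | 0 <= r])) `&`
    ((fun x => \sum_i x i) @^-1` [set r : R | r = 1]).
  apply/seteqP; split=> x.
    by move=> [x0 x1]; split=> // i _; exact: x0.
  by move=> [x0 x1]; split=> // i; exact: x0.
apply: closedI.
  apply: closed_bigI => i _; apply: preimage_closed; last exact: closed_ge.
  by move=> x _; exact: coordC.
apply: preimage_closed; last exact: closed_eq.
move=> x _; exact: continuous_sum.
Qed.

Lemma lebesgue_number (I : Type) (O : I -> set Delta) :
  (forall i, open (O i)) -> (forall x, exists i, O i x) ->
  exists2 e, 0 < e & forall x, exists i, forall y, near_pt e x y -> O i y.
Proof.
move=> oO cO.
(* Compactness is known for a subset of the ambient product, so [Pr] speaks of ambient points and of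
   the simplex points above them. *)
pose Pr (e : R) (x' : {ptws 'I_p.+1 -> R}) := forall x : Delta, set_val x = x' ->
  exists i, forall y, near_pt e x y -> O i y.
have /(iffLR (@compact_near_coveringP _ _)) := compact_std_simplex.
move=> /(_ _ (0^'+ : set_system R) Pr _) [| e0 /= e0_gt0 e0P].
- move=> x xs; have xD : x \in @std_simplex R p by rewrite inE.
  have [i Oi] := cO (SigSub xD).
  have [d d0 dP] := nbhs_near_pt (open_nbhs_nbhs (conj (oO i) Oi)).
  (* Half of the radius is spent on moving the centre, half on the ball around it. *)
  exists ([set x' | forall j, `|x j - x' j| <= d / 2], [set e | e <= d / 2]).
    split=> /=; last by apply: nbhs_right_le; rewrite divr_gt0.
    apply: (@near_dist_le _ _ _ (fun j (y : {ptws 'I_p.+1 -> R}) => y j)).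
      by move=> j z; exact: proj_continuous.
    by rewrite divr_gt0.
  move=> [x' e] /= [xx' ed] y yE; exists i => z yz; apply: dP => j /=.
  rewrite (splitr d); apply: (le_trans (ler_distD (x' j) _ _)).
  apply: lerD; first exact: xx'.
  by rewrite -yE; apply: le_trans ed; exact: yz.
exists (e0 / 2); first by rewrite divr_gt0.
move=> x; apply: (e0P (e0 / 2) _ _ _ (set_valP x)) => //=.
  by rewrite sub0r normrN gtr0_norm ?divr_gt0 // gtr_pMr // invf_lt1 ?ltr1n.
by rewrite divr_gt0.
Qed.

End Lebesgue.

(** * Small simplices *)

Section SmallSimplices.
Variables (R : realType) (T : topologicalType).
Implicit Types (A Y : set T).

Definition lands A q (s : sing R T q) := forall x, A (s x).

Lemma lands_sing_map A p q (f : 'I_p.+1 -> 'I_q.+1) (s : sing R T q) :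
  lands A s -> lands A (sing_map f s).
Proof. by move=> As x; apply: As. Qed.

Lemma landsW A B q (s : sing R T q) : A `<=` B -> lands A s -> lands B s.
Proof. by move=> AB As x; exact/AB/As. Qed.

(** Turns [c] into a functional on lists of points of the domain of [s], to which [subdiv] and
    [subdivT] apply. *)
Definition sub_eval q p (c : cochain R T q) (s : sing R T p) : seq (stdsimplex R p) -> 'F_2 :=
  ev_seq vertex0 (fun k w => s \o @affine R k p w) c.

Lemma affine_sing_continuous k p (s : sing R T p) (w : 'I_k.+1 -> stdsimplex R p) :
  continuous (s \o affine w).
Proof.
by move=> x; apply: continuous_comp; [exact: affine_continuous | exact: cts_fun].
Qed.

Lemma sub_eval_coboundary q p (c : cochain R T q) (s : sing R T p) t : size t = q.+2 ->
  sub_eval (coboundary c) s t = bd (sub_eval c s) t.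
Proof.
move=> tq; apply: ev_seq_coboundary => //; last exact: affine_sing_continuous.
by move=> k l f w x /=; rewrite affine_map.
Qed.

Lemma sub_eval_vanish A q p (c : cochain R T q) (s : sing R T p) t :
  (forall u : sing R T q, lands A u -> c u = 0) ->
  (forall x, A (s (affine (fun i : 'I_q.+1 => nth vertex0 t i) x))) -> sub_eval c s t = 0.
Proof. by move=> c0 As; apply: ev_eq0 => u su; apply: c0 => x; rewrite -su; exact: As. Qed.

Lemma sub_eval_vertices q (c : cochain R T q) (s : sing R T q) :
  sub_eval c s (vertices q) = c s.
Proof.
apply: evE => x /=; congr (s _); rewrite -[RHS]affine_vertices.
by congr affine; apply/funext => i; rewrite nth_vertices.
Qed.

Lemma sub_eval_affine q k p (c : cochain R T q) (s : sing R T p) (u : sing R T k)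
    (w : 'I_k.+1 -> stdsimplex R p) t : size t = q.+1 ->
  u =1 s \o affine w -> sub_eval c u t = sub_eval c s (map (affine w) t).
Proof.
move=> tq us; rewrite /sub_eval /ev_seq; congr ev; apply/funext => x /=.
rewrite us /= affine_comp; congr (s (affine _ _)); apply/funext => i.
by rewrite (nth_map vertex0) // tq.
Qed.

Lemma face_affine q (s : sing R T q.+1) (v : 'I_q.+2) :
  sing_map (lift v) s =1 s \o affine (fun i => vertex R (lift v i)).
Proof.
by move=> x /=; congr (s _); rewrite (affine_map (lift v) (@vertex R q.+1)) affine_vertices.
Qed.

Lemma face_vertices q (v : 'I_q.+2) :
  map (affine (fun i => vertex R (lift v i))) (vertices q) =
  map (@vertex R q.+1) (map (lift v) (enum 'I_q.+1)).
Proof. by rewrite -!map_comp; apply: eq_map => i /=; rewrite affine_vertex. Qed.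

Variables (I : Type) (U : I -> set T) (Y : set T).
Hypotheses (oU : forall i, open (U i)) (YU : forall y, Y y -> exists i, U i y).

(** After enough subdivisions every piece is smaller than a Lebesgue number of the preimages of the
    [U i], hence lands in some [U i], where [c] is zero. *)
Lemma sd_vanish q p (c : cochain R T q) (s : sing R T p) : lands Y s ->
  (forall i (u : sing R T q), lands (Y `&` U i) u -> c u = 0) ->
  exists m, forall k, (m <= k)%N -> forall t, size t = q.+1 ->
    iter k (@sd R p) (sub_eval c s) t = 0.
Proof.
move=> Ys c0.
have [i|x|e e0 eP] := @lebesgue_number R p I (fun i => s @^-1` U i).
- by apply: open_comp => // x _; exact: cts_fun.
- exact/YU/Ys.
have [m mP] := kappa_small q.+1 e0; exists m => k mk t tq.
apply: (@iter_sd_small _ _ q.+1 k q.+1 1) => //; first exact: small1.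
move=> t' tq' st'; have t0 : (0 < size t')%N by rewrite tq'.
have [i iP] := eP (nth vertex0 t' 0).
apply: (@sub_eval_vanish (Y `&` U i)); first exact: c0.
move=> x; split; first exact: Ys.
apply: iP => j; rewrite affineE.
(* A point of the affine simplex is a convex combination of vertices that are all within [e] of the
   first one. *)
rewrite -[X in `|X - _|]mul1r -(simplex_sum1 x) mulr_suml -sumrB.
apply: (le_trans (ler_norm_sum _ _ _)).
rewrite -[e]mul1r -(simplex_sum1 x) mulr_suml; apply: ler_sum => l _.
rewrite -mulrBr normrM ger0_norm ?simplex_ge0 // ler_wpM2l ?simplex_ge0 //.
apply: le_trans (mP _ mk); rewrite -[leRHS]mulr1.
by apply: st'; apply: mem_nth => //; rewrite tq'.
Qed.

Lemma iter_sd0 p k (f : seq (stdsimplex R p) -> 'F_2) :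
  (forall t, f t = 0) -> forall t, iter k (@sd R p) f t = 0.
Proof.
move=> f0; elim: k => //= k IH t; rewrite /sd -[RHS](subdiv0 bary (size t) t).
by apply: subdiv_eq.
Qed.

Lemma iter_sd_map p l k n (w : 'I_k.+1 -> stdsimplex R p)
    (g : seq (stdsimplex R k) -> 'F_2) (f : seq (stdsimplex R p) -> 'F_2) t :
  (forall t, size t = n -> g t = f (map (affine w) t)) -> size t = n ->
  iter l (@sd R k) g t = iter l (@sd R p) f (map (affine w) t).
Proof.
move=> gf; elim: l t => [|l IH] t tn /=; first exact: gf.
rewrite /sd size_map (subdiv_map (b := bary)) //; last exact: affine_bary.
by apply: subdiv_eq => // u un; apply: IH; rewrite un tn.
Qed.

(* The cochain [d] is the sum over [k] of the subdivision homotopy applied to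
   the [k]-th subdivision of [c]; evaluated on a given simplex, only finitely
   many terms of this sum are nonzero. *)
Theorem small_simplices q (c : cochain R T q.+1) :
  (forall s : sing R T q.+2, lands Y s -> coboundary c s = 0) ->
  (forall i (s : sing R T q.+1), lands (Y `&` U i) s -> c s = 0) ->
  exists2 d : cochain R T q,
    (forall i (s : sing R T q), lands (Y `&` U i) s -> d s = 0) &
    forall s : sing R T q.+1, lands Y s -> c s = coboundary d s.
Proof.
move=> dc c0.
pose term (s : sing R T q) k :=
  subdivT bary q.+1 (iter k (@sd R q) (sub_eval c s)) (vertices q).
have term0 (s : sing R T q) : exists m, lands Y s -> forall k, (m <= k)%N -> term s k = 0.
  have [Ys|nYs] := pselect (lands Y s); last by exists 0%N.
  have [m mP] := sd_vanish Ys c0; exists m => _ k mk.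
  rewrite /term -[RHS](subdivT0 bary q.+1 (@vertices R q)).
  by apply: subdivT_eq; rewrite ?size_vertices // => t; exact: mP.
have [m mP] := choice term0.
have term_sum (s : sing R T q) M : lands Y s -> (m s <= M)%N ->
    \sum_(k < M) term s k = \sum_(k < m s) term s k.
  move=> Ys mM; rewrite -!(big_mkord xpredT (term s)) (big_cat_nat (leq0n _) mM) //=.
  rewrite [X in _ + X]big_nat_cond [X in _ + X]big1 ?addr0 // => k /andP[/andP[mk _] _].
  exact: mP.
exists (fun s => \sum_(k < m s) term s k) => [i s Us|s Ys].
  apply: big1 => k _; rewrite /term -[RHS](subdivT0 bary q.+1 (@vertices R q)).
  apply: subdivT_eq; rewrite ?size_vertices // => t _; apply: iter_sd0 => u.
  by apply: (@sub_eval_vanish (Y `&` U i)) => [|x]; [exact: c0 | exact: Us].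
have [N NP] := sd_vanish Ys c0.
(* [M] bounds the number of relevant terms for [s] and for all its faces, so a single range of
   summation serves them all. *)
pose M := maxn N (\max_(v < q.+2) m (sing_map (lift v) s)).
pose g k := iter k (@sd R q.+1) (sub_eval c s).
have gcyc k t : size t = q.+3 -> bd (g k) t = 0.
  elim: k t => [|k IH] t tq.
    rewrite /g /= -sub_eval_coboundary //; apply: (@sub_eval_vanish Y) => [|x].
      exact: dc.
    exact: Ys.
  have -> : bd (g k.+1) t = subdiv bary q.+3 (bd (g k)) t.
    rewrite subdiv_bd //; apply: bd_eq_size => u; rewrite tq => -[uq].
    by rewrite /g /= /sd uq.
  rewrite -[RHS](subdiv0 bary q.+3 t); exact: subdiv_eq.
(* The homotopy term on [bd (g k)] vanishes because a subdivided cocycle is still a cocycle. *)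
have step k : g k (vertices q.+1) + g k.+1 (vertices q.+1) =
    bd (subdivT bary q.+1 (g k)) (vertices q.+1).
  have sv : size (@vertices R q.+1) = q.+2 by rewrite size_vertices.
  have -> : g k.+1 (vertices q.+1) = subdiv bary q.+2 (g k) (vertices q.+1).
    by rewrite /g iterS {1}/sd sv.
  rewrite -(subdivT_bd bary (g k) sv) -[RHS]add0r; congr (_ + _).
  rewrite -[RHS](subdivT0 bary q.+2 (@vertices R q.+1)).
  by apply: subdivT_eq => // t tq; exact: gcyc.
have tele n : c s + g n (vertices q.+1) =
    \sum_(k < n) bd (subdivT bary q.+1 (g k)) (vertices q.+1).
  elim: n => [|n IH]; first by rewrite big_ord0 /g /= sub_eval_vertices F2_addrr.
  rewrite big_ord_recr -IH -step.
  move: (c s) (g n _) (g n.+1 _) => x y z.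
  by rewrite [RHS]addrA -(addrA x) F2_addrr addr0.
have := tele M; rewrite [g M _](NP M (leq_maxl _ _)) ?size_vertices // addr0 => ->.
rewrite -bd_sum /vertices bd_map bd_enum; apply: eq_bigr => v _.
have vM : (m (sing_map (lift v) s) <= M)%N.
  by apply: leq_trans (leq_maxr _ _); exact: (leq_bigmax v).
rewrite -(term_sum _ M) //; last exact: lands_sing_map.
apply: eq_bigr => k _; rewrite -face_vertices.
rewrite /term (subdivT_map (b := bary)) ?size_vertices //; last exact: affine_bary.
apply: subdivT_eq; rewrite ?size_vertices // => t tq.
symmetry; apply: (@iter_sd_map _ _ _ q.+2) => // u uq; exact/sub_eval_affine/face_affine.
Qed.

End SmallSimplices.

Arguments sq_cochain {R T} n {q} a _.
Arguments cup {R T} i {p q} N a b _.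

(** * Steenrod squares on subspaces *)

Section OnSubspace.
Variables (R : realType) (T : topologicalType).
Implicit Types (A B : set T).

Definition cocycle_on A q (a : cochain R T q) :=
  forall s : sing R T q.+1, lands A s -> coboundary a s = 0.

Definition exact_on A q : cochain R T q -> Prop :=
  match q with
  | 0 => fun a => forall s : sing R T 0, lands A s -> a s = 0
  | p.+1 => fun a => exists b : cochain R T p,
      forall s : sing R T p.+1, lands A s -> a s = coboundary b s
  end.

(* Singular simplices of [A] are the singular simplices of [T] landing in [A]. *)
Definition sq_nontrivial_on A n := exists q (a : cochain R T q),
  cocycle_on A a /\ ~ exact_on A (sq_cochain n a).

Lemma coboundary_local A q (a b : cochain R T q) (s : sing R T q.+1) :
  (forall u : sing R T q, lands A u -> a u = b u) -> lands A s ->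
  coboundary a s = coboundary b s.
Proof. by move=> ab As; apply: eq_bigr => v _; apply: ab; exact: lands_sing_map. Qed.

Lemma eval_on_local A p N (a b : cochain R T p) (s : sing R T N) J :
  (forall u : sing R T p, lands A u -> a u = b u) -> lands A s ->
  eval_on a s J = eval_on b s J.
Proof.
by move=> ab As; rewrite /eval_on; case: ifP => // _; apply: ab; exact: lands_sing_map.
Qed.

Lemma cup_local A i p q N (a a' : cochain R T p) (b b' : cochain R T q) (s : sing R T N) :
  (forall u : sing R T p, lands A u -> a u = a' u) ->
  (forall u : sing R T q, lands A u -> b u = b' u) -> lands A s ->
  cup i N a b s = cup i N a' b' s.
Proof.
move=> aa bb As; apply: eq_bigr => J _.
by rewrite (eval_on_local _ aa As) (eval_on_local _ bb As).
Qed.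

Lemma exact_on_local A q (a b : cochain R T q) :
  (forall s : sing R T q, lands A s -> a s = b s) -> exact_on A a -> exact_on A b.
Proof.
case: q a b => [|q] a b ab /=; first by move=> a0 s As; rewrite -ab // a0.
by move=> [c ac]; exists c => s As; rewrite -ab // ac.
Qed.

Lemma exact_onD A q (a b : cochain R T q) :
  exact_on A a -> exact_on A b -> exact_on A (a + b).
Proof.
case: q a b => [|q] a b /=.
  by move=> a0 b0 s As; rewrite -[LHS]/(a s + b s) a0 // b0 // addr0.
move=> [c ac] [d bd]; exists (c + d) => s As.
by rewrite coboundaryD -[LHS]/(a s + b s) ac // bd.
Qed.

Lemma exact_onW A B q (a : cochain R T q) : A `<=` B -> exact_on B a -> exact_on A a.
Proof.
case: q a => [|q] a AB /=; first by move=> a0 s As; apply: a0; exact: landsW As.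
by move=> [c ac]; exists c => s As; apply: ac; exact: landsW As.
Qed.

Lemma cocycle_onW A B q (a : cochain R T q) : A `<=` B -> cocycle_on B a -> cocycle_on A a.
Proof. by move=> AB ca s As; apply: ca; exact: landsW As. Qed.

Lemma coboundary_eval0 A q (a : cochain R T q) (s : sing R T q.+1) :
  (forall u : sing R T q, lands A u -> a u = 0) -> lands A s -> coboundary a s = 0.
Proof. by move=> a0 As; apply: big1 => v _; apply: a0; exact: lands_sing_map. Qed.

(** On an empty [A] every cochain is exact, since no simplex lands there. *)
Lemma sq_nontrivial_on_nonempty A n : sq_nontrivial_on A n -> exists x, A x.
Proof.
move=> [q [a [_ na]]]; apply: contrapT => nA; apply: na.
have noA p (s : sing R T p) : ~ lands A s.
  by move=> As; apply: nA; exists (s vertex0); exact: As.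
case: (q + n)%N (sq_cochain n a) => [|p] b; first by move=> s /noA.
by exists 0 => s /noA.
Qed.

Lemma sq_nontrivial_setT n : sq_nontrivial_on setT n <-> sq_nontrivial R T n.
Proof.
have exactT q (a : cochain R T q) : exact_on setT a <-> is_coboundary a.
  case: q a => [|q] a /=; split.
  - by move=> a0; apply/funext => s; apply: a0.
  - by move=> ->.
  - by move=> [b ab]; exists b; apply/funext => s; apply: ab.
  - by move=> [b ->]; exists b.
split=> [[q [a [ca na]]]|[q [x]]].
  have aP : a \in @is_cocycle R T q by apply/eqP/funext => s; exact: ca.
  exists q, (\pi_(cohomology R T q)%qT (Cocycle aP)); rewrite Sq_pi.
  apply: contra_notN na => /eqP sq0; apply/exactT; move: sq0.
  rewrite -[0 in RHS](raddf0 (\pi_(cohomology R T (q + n))%qT)) => /eqP.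
  by rewrite -Quotient.idealrBE => /asboolP /=; rewrite subr0.
rewrite /Sq => nx; exists q, (cocycle_val (repr x)); split.
  by move=> s _; rewrite (eqP (cocycleP (repr x))).
move=> /exactT ex; move/negP: nx; apply; apply/eqP.
rewrite -(raddf0 (\pi_(cohomology R T (q + n))%qT)); apply/eqP.
rewrite -Quotient.idealrBE; apply/asboolP; by rewrite subr0.
Qed.

End OnSubspace.
Arguments sq_nontrivial_on R {T} A n.

(** * Pulling back cochains *)

Section Pullback.
Variables (R : realType) (X Y : topologicalType).

(** Continuity is tested along singular simplices only, because the maps used below are total
    functions that have to behave well on [A] alone. *)
Definition continuous_on_sing (f : X -> Y) (A : set X) :=
  forall q (s : sing R X q), lands A s -> continuous (f \o s).

Definition pull (f : X -> Y) q (c : cochain R Y q) : cochain R X q :=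
  fun s => ev c (f \o s).

Variables (f : X -> Y) (A : set X).
Hypothesis cf : continuous_on_sing f A.

Section Push.
Variables (q : nat) (s : sing R X q).
Hypothesis As : lands A s.

Definition push_sing : sing R Y q := mkcts (cf As).

Lemma pullE p (c : cochain R Y p) (w : 'I_p.+1 -> 'I_q.+1) :
  pull f c (sing_map w s) = c (sing_map w push_sing).
Proof. exact: evE. Qed.

Lemma pull_sing (c : cochain R Y q) : pull f c s = c push_sing.
Proof. exact: evE. Qed.
End Push.

Lemma coboundary_pull q (c : cochain R Y q) (s : sing R X q.+1) : lands A s ->
  coboundary (pull f c) s = pull f (coboundary c) s.
Proof. by move=> As; rewrite (pull_sing As); apply: eq_bigr => v _; rewrite (pullE As). Qed.

Lemma sq_pull n q (c : cochain R Y q) (s : sing R X (q + n)) : lands A s ->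
  sq_cochain n (pull f c) s = pull f (sq_cochain n c) s.
Proof.
move=> As; rewrite (pull_sing As) /sq_cochain; case: ifP => // _.
by apply: eq_bigr => J _; rewrite /eval_on !(pullE As).
Qed.

End Pullback.

(** Pulling back along [f] and then [g] is the identity on cochains of [B], so a primitive of the
    square on [A] would pull back to one on [B]. *)
Lemma sq_nontrivial_retract (R : realType) (X Y : topologicalType) (A : set X) (B : set Y)
    (f : X -> Y) (g : Y -> X) n :
  continuous_on_sing R f A -> continuous_on_sing R g B ->
  (forall x, A x -> B (f x)) -> (forall y, B y -> A (g y)) ->
  (forall y, B y -> f (g y) = y) ->
  sq_nontrivial_on R B n -> sq_nontrivial_on R A n.
Proof.
move=> cf cg fAB gBA fg [q [a [ca na]]]; exists q, (pull f a); split.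
  move=> s As; rewrite (coboundary_pull cf) // (pull_sing cf As); apply: ca => x.
  exact/fAB/As.
have pull2 p (c : cochain R Y p) (s : sing R Y p) : lands B s ->
    pull g (pull f c) s = c s.
  move=> Bs; rewrite (pull_sing cg Bs); apply: evE => x /=; exact/fg/Bs.
have landsA p (s : sing R Y p) (Bs : lands B s) : lands A (push_sing cg Bs).
  by move=> x; exact/gBA/Bs.
apply: contra_not na; move: (sq_cochain n a) (@sq_pull _ _ _ _ _ cf n q a) => b.
move: (sq_cochain n _) => c; case: (q + n)%N b c => [|p] b c cb /=.
  by move=> c0 s Bs; rewrite -pull2 // (pull_sing cg Bs) -cb ?c0 //; exact: landsA.
move=> [e ce]; exists (pull g e) => s Bs.
rewrite -[LHS]pull2 // (pull_sing cg Bs) -cb ?ce; try exact: landsA.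
by rewrite (coboundary_pull cg) // (pull_sing cg Bs).
Qed.

(** * Subspaces as types *)

Section SetType.
Variables (R : realType) (T : topologicalType) (A : set T).

Lemma sing_set_type q (s : sing R T q) : lands A s ->
  forall g : T -> set_type A, (forall x, A x -> set_val (g x) = x) -> continuous (g \o s).
Proof.
move=> As g gK; apply: continuous_comp_initial.
rewrite (_ : _ \o _ = s); first exact: cts_fun.
by apply/funext => x /=; apply: gK.
Qed.

Lemma set_val_continuous_on B : continuous_on_sing R (@set_val T A) B.
Proof.
move=> q s _ x; apply: continuous_comp; first exact: cts_fun.
exact: initial_continuous.
Qed.

Lemma sq_nontrivial_set_type n :
  sq_nontrivial_on R [set: set_type A] n <-> sq_nontrivial_on R A n.
Proof.
(* A point of [A] supplies the default value of [g] outside [A]. *)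
have inv : (exists x, A x) -> exists g : T -> set_type A, forall x, A x -> set_val (g x) = x.
  move=> [x0 Ax0]; have x0A : x0 \in A by rewrite inE.
  exists (fun x => if pselect (A x) is left Ax then SigSub (mem_set Ax) else SigSub x0A).
  by move=> x Ax; case: pselect.
have cval := set_val_continuous_on.
split=> nA; have /inv [g gK] : exists x, A x.
- by have [x _] := sq_nontrivial_on_nonempty nA; exists (set_val x); exact: set_valP.
- apply: (sq_nontrivial_retract (f := g) (g := set_val)) nA => //.
  + by move=> q s As; exact: sing_set_type.
  + by move=> x _; exact: set_valP.
  + by move=> y _; apply: val_inj; exact/gK/set_valP.
- exact: sq_nontrivial_on_nonempty nA.
apply: (sq_nontrivial_retract (f := set_val) (g := g)) nA => //.
- by move=> q s As; exact: sing_set_type.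
- by move=> x _; exact: set_valP.
Qed.

End SetType.

(** * Homotopies *)

Section Homotopy.
Variables (R : realType) (T : topologicalType).
Implicit Types (A B : set T) (h : R -> T -> T).

(** Joint continuity in time and point, tested along singular simplices with a varying time, in the
    spirit of [continuous_on_sing]. *)
Definition homotopy_on A h := forall q (s : sing R T q) (t : stdsimplex R q -> R),
  continuous t -> (forall x, 0 <= t x <= 1) -> lands A s -> continuous (fun x => h (t x) (s x)).

(* The affine simplex of [Delta^q * [0, 1]] with the given vertices, the boolean
   being the end of the interval, pushed to [T] by [h]. *)
Definition prism_sing h q (s : sing R T q) k (w : 'I_k.+1 -> 'I_q.+1 * bool)
    (x : stdsimplex R k) : T :=
  h (\sum_(i | (w i).2) set_val x i) (s (simplex_map (fun i => (w i).1) x)).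

Definition hprism h q (c : cochain R T q.+1) : cochain R T q := fun s =>
  prism (pair^~ false) (pair^~ true)
    (ev_seq (ord0, false) (@prism_sing h q s) c) (enum 'I_q.+1).

Lemma prism_sing_map h q (s : sing R T q) k l (f : 'I_k.+1 -> 'I_l.+1)
    (w : 'I_l.+1 -> 'I_q.+1 * bool) :
  prism_sing h s (w \o f) =1 prism_sing h s w \o simplex_map f.
Proof.
move=> x; rewrite /prism_sing /= simplex_map_comp; congr h.
rewrite (partition_big f (fun j => (w j).2)) //=; apply: eq_bigr => j wj.
by apply: eq_bigl => i; case: eqP => [->|]; rewrite ?wj ?andbF.
Qed.

Lemma prism_time k (P : pred 'I_k.+1) (x : stdsimplex R k) :
  0 <= \sum_(i | P i) set_val x i <= 1.
Proof.
rewrite sumr_ge0 => [|i _]; last exact: simplex_ge0.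
rewrite -(simplex_sum1 x) [leRHS](bigID P) /= lerDl sumr_ge0 // => i _.
exact: simplex_ge0.
Qed.

Lemma prism_sing_continuous A h q (s : sing R T q) k (w : 'I_k.+1 -> 'I_q.+1 * bool) :
  homotopy_on A h -> lands A s -> continuous (prism_sing h s w).
Proof.
move=> hA As; apply: (hA _ (sing_map (fun i => (w i).1) s)).
- by apply: continuous_sum => i; exact: simplex_coord_continuous.
- exact: prism_time.
- exact: lands_sing_map.
Qed.

Lemma hprism_face h q (c : cochain R T q.+1) (s : sing R T q.+1) (v : 'I_q.+2) :
  hprism h c (sing_map (lift v) s) =
  prism (pair^~ false) (pair^~ true) (ev_seq (ord0, false) (@prism_sing h q.+1 s) c)
    (map (lift v) (enum 'I_q.+1)).
Proof.
pose M (w : 'I_q.+1 * bool) := (lift v w.1, w.2).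
rewrite (@prism_map _ _ _ _ _ _ (pair^~ false) (pair^~ true) _ M) //.
apply: prism_eq => t; rewrite size_enum_ord => tq; congr ev; apply/funext => x.
rewrite /prism_sing; have tE (i : 'I_q.+2) : nth (ord0, false) (map M t) i = M (nth (ord0, false) t i).
  by rewrite (nth_map (ord0, false)) // tq.
congr h; first by apply: eq_bigl => i; rewrite tE.
rewrite /= /mkcts simplex_map_comp; congr (s (simplex_map _ _)).
by apply/funext => i /=; rewrite tE.
Qed.

(** The total weight of the [true] vertices is 1 on the top of the prism and 0 on the bottom, so
    [prism_bd] leaves [h 1] and [h 0]. *)
Lemma hprism_coboundary A h q (c : cochain R T q.+1) (s : sing R T q.+1) :
  homotopy_on A h -> lands A s ->
  hprism h (coboundary c) s + coboundary (hprism h c) s = pull (h 1) c s + pull (h 0) c s.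
Proof.
move=> hA As; rewrite /coboundary.
under [X in _ + X]eq_bigr do rewrite hprism_face.
rewrite -bd_enum.
have -> : hprism h (coboundary c) s =
    prism (pair^~ false) (pair^~ true) (bd (ev_seq (ord0, false) (@prism_sing h q.+1 s) c))
      (enum 'I_q.+2).
  apply: prism_eq => t; rewrite size_enum_ord => tq.
  apply: ev_seq_coboundary => //; first exact: prism_sing_map.
  exact: prism_sing_continuous hA As.
have mapid (w : 'I_q.+2 -> 'I_q.+2) x : w =1 id -> simplex_map (R := R) w x = x.
  by move=> /funext ->; rewrite simplex_map_id.
have nthE b (i : 'I_q.+2) : nth (ord0, false) (map (pair^~ b) (enum 'I_q.+2)) i = (i, b).
  by rewrite (nth_map ord0) ?size_enum_ord // nth_ord_enum.
rewrite prism_bd; congr (_ + _); congr ev; apply/funext => x; rewrite /prism_sing.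
- rewrite mapid; last by move=> i; rewrite nthE.
  rewrite -(simplex_sum1 x); congr (h _ (s x)); apply: eq_bigl => i; by rewrite nthE.
- rewrite mapid; last by move=> i; rewrite nthE.
  by rewrite big_pred0 // => i; rewrite nthE.
Qed.

Lemma hprism_vanish A B h q (c : cochain R T q.+1) (s : sing R T q) :
  (forall t x, 0 <= t <= 1 -> A x -> B (h t x)) ->
  (forall u : sing R T q.+1, lands B u -> c u = 0) -> lands A s -> hprism h c s = 0.
Proof.
move=> hAB c0 As; rewrite -[RHS](prism0 (pair^~ false) (pair^~ true) (enum 'I_q.+1)).
apply: prism_eq => t _; apply: ev_eq0 => u su; apply: c0 => x; rewrite -su.
by apply: hAB => //; exact: prism_time.
Qed.

Definition const_sing (x : T) q : sing R T q := mkcts (@cst_continuous _ _ x).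

Lemma contractible_exact A h x0 q (c : cochain R T q.+1) :
  homotopy_on A h -> (forall t x, 0 <= t <= 1 -> A x -> A (h t x)) -> A x0 ->
  (forall x, A x -> h 0 x = x) -> (forall x, A x -> h 1 x = x0) ->
  cocycle_on A c -> exact_on A c.
Proof.
move=> hA hAA Ax0 h0 h1 cc.
pose k := c (const_sing x0 q.+1).
have cE s : lands A s -> c s = coboundary (hprism h c) s + k.
  move=> As; have := hprism_coboundary c hA As.
  rewrite (hprism_vanish hAA cc As) add0r => ->.
  rewrite [pull (h 1) c s](evE c (s := const_sing x0 q.+1)); last by move=> x /=; exact: h1.
  rewrite [pull (h 0) c s](evE c (s := s)); last by move=> x /=; exact: h0.
  by rewrite [k + _]addrC -addrA F2_addrr addr0.
have natF2 n : n%:R = (odd n)%:R :> 'F_2.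
  by rewrite -[in LHS](odd_double_half n) natrD -muln2 natrM F2_two mulr0 addr0.
(* The coboundary of the constant cochain [k] multiplies it by [q.+2], which gives [k] back when
   this is odd. When it is even, the cocycle condition on a constant simplex with [q.+3] faces
   forces [k] to be zero. *)
have [oq|eq] := boolP (odd q.+2).
  exists (hprism h c + (fun=> k)) => s As; rewrite coboundaryD cE //; congr (_ + _).
  by rewrite /coboundary sumr_const card_ord -mulr_natr natF2 oq mulr1.
exists (hprism h c) => s As; rewrite cE //; suff -> : k = 0 by rewrite addr0.
have := cc (const_sing x0 q.+2) (fun=> Ax0).
rewrite /coboundary (eq_bigr (fun=> k)); last first.
  by move=> v _; congr c; apply/continuousEP.
by rewrite sumr_const card_ord -mulr_natr natF2 -[odd q.+3]/(~~ odd q.+2) eq mulr1.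
Qed.

End Homotopy.

(** * Mayer-Vietoris *)

Section Cover.
Variables (R : realType) (T : topologicalType).

(** Unlike in [cup_exact], the primitive is explicit: where [b] is a cocycle it reduces to the
    product of [b] with itself one index lower. *)
Lemma cup_coboundary_self i q N (b : cochain R T q) :
  cup i.+1 N.+1 (coboundary b) (coboundary b) =
  coboundary (cup i.+1 N b (coboundary b) + cup i N b b).
Proof.
rewrite coboundaryD coboundary_cup coboundaryK cup0r addr0 -addrA -[LHS]addr0; congr (_ + _).
symmetry; suff -> : coboundary (cup i N b b) =
    cup i N.+1 b (coboundary b) + cup i N.+1 (coboundary b) b by exact: cochain_addrr.
case: i => [|i]; first by rewrite coboundary_cup0 addrC.
by rewrite coboundary_cup cochain_addrr addr0 addrC.
Qed.

Lemma exact_on0 (A : set T) q : exact_on A (0 : cochain R T q).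
Proof. by case: q => [|q] //=; exists 0 => s _; rewrite coboundary0. Qed.

(* A cocycle [a] on the intersection is the coboundary on [U] of a cochain [b],
   and its image under the Mayer-Vietoris connecting map is a cocycle [y] equal to
   [coboundary b] on [U] and to [0] on [V]. If [Sq y] is the coboundary of [eta],
   comparing [eta] on [U] with an explicit primitive of [Sq (coboundary b)] shows
   that [Sq a] is exact. *)
Lemma sq_nontrivial_cover (U V Y : set T) n : open U -> open V -> Y `<=` U `|` V ->
  (0 < n)%N ->
  (forall q (c : cochain R T q), (0 < q)%N -> cocycle_on (Y `&` U) c -> exact_on (Y `&` U) c) ->
  (forall q (c : cochain R T q), (0 < q)%N -> cocycle_on (Y `&` V) c ->
    exists2 c', (forall s : sing R T q.+1, lands Y s -> coboundary c' s = coboundary c s) &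
       exact_on (Y `&` V) c') ->
  sq_nontrivial_on R (Y `&` (U `&` V)) n -> sq_nontrivial_on R Y n.
Proof.
move=> oU oV YUV n0 exU exV [q [a [ca na]]]; set W := Y `&` _ in ca na.
have nq : (n <= q)%N.
  by apply: contra_notT na => nq; rewrite /sq_cochain (negPf nq); exact: exact_on0.
have WU : W `<=` Y `&` U by move=> x [Yx [Ux _]].
have WV : W `<=` Y `&` V by move=> x [Yx [_ Vx]].
pose b : cochain R T q := fun s => if `[< lands W s >] then a s else 0.
have ba (s : sing R T q) : lands W s -> b s = a s by move=> Ws; rewrite /b asboolT.
pose c : cochain R T q.+1 := fun s => if `[< lands (Y `&` U) s >] then coboundary b s else 0.
have cU (s : sing R T q.+1) : lands (Y `&` U) s -> c s = coboundary b s.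
  by move=> Us; rewrite /c asboolT.
have dbW (s : sing R T q.+1) : lands W s -> coboundary b s = 0.
  by move=> Ws; rewrite (coboundary_local ba Ws) ca.
have cV (s : sing R T q.+1) : lands (Y `&` V) s -> c s = 0.
  move=> Vs; rewrite /c; case: asboolP => // Us; apply: dbW => x.
  by have [Yx Ux] := Us x; have [_ Vx] := Vs x.
have dcU (s : sing R T q.+2) : lands (Y `&` U) s -> coboundary c s = 0.
  by move=> Us; rewrite (coboundary_local cU Us) coboundaryK.
have dcV (s : sing R T q.+2) : lands (Y `&` V) s -> coboundary c s = 0.
  exact: coboundary_eval0.
(* So far [c] is a cocycle only on simplices inside [U] or inside [V]. The correction [d] vanishes
   on these and makes [y] a cocycle on all of [Y]. *)
have [] := @small_simplices R T bool (fun i => if i then U else V) Y _ _ q.+1 (coboundary c).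
- by case.
- by move=> x /YUV[Ux|Vx]; [exists true | exists false].
- by move=> s _; rewrite coboundaryK.
- by case.
move=> d d0 cd; pose y := c + d.
have yU (s : sing R T q.+1) : lands (Y `&` U) s -> y s = coboundary b s.
  by move=> Us; rewrite -[LHS]/(c s + d s) cU // (d0 true) // addr0.
have yV (s : sing R T q.+1) : lands (Y `&` V) s -> y s = 0.
  by move=> Vs; rewrite -[LHS]/(c s + d s) cV // (d0 false) // addr0.
exists q.+1, y; split.
  by move=> s Ys; rewrite coboundaryD -[LHS]/(coboundary c s + coboundary d s) cd // F2_addrr.
apply: contra_not na => -[eta etaE].
(* On simplices in [U] this is a primitive of the square of [y]; on [W] it is the square of [a]. *)
pose beta := cup (q - n).+1 (q + n) b (coboundary b) + cup (q - n) (q + n) b b.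
have sqU (s : sing R T (q + n).+1) : lands (Y `&` U) s ->
    sq_cochain n y s = coboundary beta s.
  move=> Us; rewrite -cup_coboundary_self /sq_cochain leqW // subSn //.
  exact: (cup_local _ yU yU).
have sqV (s : sing R T (q + n).+1) : lands (Y `&` V) s -> sq_cochain n y s = 0.
  move=> Vs; rewrite /sq_cochain leqW //.
  have y0 (u : sing R T q.+1) : lands (Y `&` V) u -> y u = (0 : cochain R T q.+1) u by exact: yV.
  by rewrite (cup_local _ y0 y0 Vs) cup0l.
have qn0 : (0 < q + n)%N by rewrite addn_gt0 n0 orbT.
(* On the part in [V], [y] and hence its square vanish, so [eta] is a cocycle there; [eta'] has the
   same coboundary on [Y] and is exact on that part. *)
have [|eta' eta'E ex1] := exV _ eta qn0.
  move=> s Vs; rewrite -etaE ?sqV //; exact: landsW Vs.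
have ex2 : exact_on (Y `&` U) (eta' + beta).
  apply: exU => // s Us; have Ys : lands Y s by apply: landsW Us.
  rewrite coboundaryD -[LHS]/(coboundary eta' s + coboundary beta s).
  by rewrite eta'E // -etaE // sqU // F2_addrr.
(* The two exact cochains add up to [beta] mod 2. *)
have := exact_onD (exact_onW WV ex1) (exact_onW WU ex2).
rewrite addrA cochain_addrr add0r; apply: exact_on_local => s Ws.
rewrite /sq_cochain nq -[LHS]/(cup _ _ b _ s + cup _ _ b _ s).
have b0 (u : sing R T q.+1) : lands W u -> coboundary b u = (0 : cochain R T q.+1) u.
  by move=> Wu; rewrite dbW.
rewrite (cup_local _ ba b0 Ws) cup0r [_ s]/(0) add0r; exact: (cup_local _ ba ba).
Qed.

End Cover.

(** * Collapsing a union of open pieces *)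

Section Collapse.
Variables (R : realType) (T : topologicalType) (I : finType).
Variables (Y : set T) (O : I -> set T) (e : I -> T -> T) (h : I -> R -> T -> T).
Let F v := Y `&` O v.
Hypotheses (oO : forall v, open (O v)) (ce : forall v, continuous_on_sing R (e v) Y).
Hypotheses (eF : forall v x, Y x -> F v (e v x)) (eFF : forall v w x, F w x -> F w (e v x)).
Hypotheses (hF : forall v, homotopy_on (F v) (h v)).
Hypothesis hFF : forall v w t x, 0 <= t <= 1 -> F v x -> F w x -> F w (h v t x).
Hypotheses (h0 : forall v x, F v x -> h v 0 x = x) (h1 : forall v x, F v x -> h v 1 x = e v x).

(* The product of the operators [1 + e_v^*] for [v] in [l] *)
Fixpoint collapse (l : seq I) q (c : cochain R T q) : cochain R T q :=
  if l is v :: l' then collapse l' c + pull (e v) (collapse l' c) else c.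

Lemma pull0 v (A B : set T) q (c : cochain R T q) (s : sing R T q) :
  (forall x, A x -> B (e v x)) -> (forall u : sing R T q, lands B u -> c u = 0) ->
  lands A s -> pull (e v) c s = 0.
Proof. by move=> AB c0 As; apply: ev_eq0 => u su; apply: c0 => x; rewrite -su; exact/AB/As. Qed.

(** The image of [e v] lies in [F v], where [c] is a cocycle, so the pulled back summands add
    nothing to the coboundary. *)
Lemma coboundary_collapse l q (c : cochain R T q) (s : sing R T q.+1) :
  (forall v, cocycle_on (F v) c) -> lands Y s -> coboundary (collapse l c) s = coboundary c s.
Proof.
move=> cc; elim: l s => //= v l IH s Ys.
rewrite coboundaryD -[LHS]/(coboundary _ s + coboundary (pull _ _) s).
rewrite (coboundary_pull (ce (v := v))) // IH //.
rewrite (@pull0 _ Y (F v)) ?addr0 //; first exact: eF.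
by move=> u Fu; rewrite IH; [exact: cc Fu | apply: landsW Fu => x []].
Qed.

(* Once [collapse l c] is the coboundary of [d] on the earlier pieces, the prism
   operator of [h v] on [F v], extended by zero, corrects [d] for the next [v]: it
   vanishes on the earlier pieces because [h v] preserves them. *)
Lemma collapse_exact l q (c : cochain R T q.+1) : (forall v, cocycle_on (F v) c) ->
  exists d : cochain R T q, forall v, v \in l ->
    forall s : sing R T q.+1, lands (F v) s -> collapse l c s = coboundary d s.
Proof.
move=> cc; elim: l => [|v l [d dP]] /=; first by exists 0.
pose k := collapse l c; pose th := k + coboundary d.
have FY w : F w `<=` Y by move=> x [].
have th0 w : w \in l -> forall s : sing R T q.+1, lands (F w) s -> th s = 0.
  by move=> wl s Fs; rewrite -[LHS]/(k s + coboundary d s) /k (dP w wl s Fs) F2_addrr.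
have dth (s : sing R T q.+2) : lands (F v) s -> coboundary th s = 0.
  move=> Fs; rewrite coboundaryD coboundaryK addr0 coboundary_collapse //; last exact: landsW Fs.
  exact: cc Fs.
pose d' : cochain R T q := fun s => if `[< lands (F v) s >] then hprism (h v) th s else 0.
have d'v (s : sing R T q) : lands (F v) s -> d' s = hprism (h v) th s.
  by move=> Fs; rewrite /d' asboolT.
exists (d + pull (e v) d + d') => w wl s Fs.
have Ys := landsW (@FY w) Fs.
(* Here [th] is the failure of [d] to be a primitive; the rest of the identity is linear in [k] and
   [coboundary d]. *)
suff key : th s + pull (e v) th s = coboundary d' s.
  rewrite !coboundaryD -[LHS]/(k s + pull (e v) k s).
  rewrite -[RHS]/(coboundary d s + coboundary (pull (e v) d) s + coboundary d' s).
  rewrite (coboundary_pull (ce (v := v))) // -key.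
  have -> : pull (e v) th s = pull (e v) k s + pull (e v) (coboundary d) s.
    by rewrite !(pull_sing (ce (v := v)) Ys).
  rewrite -[th s]/(k s + coboundary d s).
  move: (k s) (coboundary d s) (pull _ k s) (pull _ (coboundary d) s) => x y z t.
  have z2 (u : 'F_2) : u *+ 2 = 0 by rewrite mulr2n F2_addrr.
  by rewrite [RHS](_ : _ = x + z + (y *+ 2 + t *+ 2)); [rewrite !z2 !addr0|ring].
(* On [F v] this is the homotopy formula. On an earlier [F w] both sides vanish: [e v] maps [F w] to
   itself and [h v] keeps the points of both pieces in [F w]. *)
move: wl; rewrite inE => /predU1P[wv|wl].
  rewrite wv in Fs; rewrite (coboundary_local d'v Fs).
  have := hprism_coboundary th (hF (v := v)) Fs.
  have hFv t x : 0 <= t <= 1 -> F v x -> F v (h v t x) by move=> t01 Fx; exact: hFF.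
  rewrite (hprism_vanish hFv dth Fs) add0r => ->.
  rewrite addrC; congr (_ + _).
    by congr ev; apply/funext => x /=; rewrite h1.
  by rewrite [RHS](evE _ (s := s)) // => x /=; rewrite h0.
rewrite (th0 w) // add0r (@pull0 _ (F w) (F w)) //; last exact: (th0 w); last first.
  by move=> x; exact: eFF.
symmetry; apply: (coboundary_eval0 _ Fs) => u Fu.
rewrite /d'; case: asboolP => // Fv.
apply: (@hprism_vanish _ _ (F v `&` F w) (F w)) => //; last exact: (th0 w).
by move=> t x t01 [Fvx Fwx]; exact: hFF.
Qed.

(** [collapse_exact] gives a primitive on simplices inside a single piece; [small_simplices] extends
    exactness to the simplices of the union. *)
Lemma collapse_primitive q (c : cochain R T q) : (0 < q)%N ->
  cocycle_on (Y `&` \bigcup_v O v) c ->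
  exists2 c', (forall s : sing R T q.+1, lands Y s -> coboundary c' s = coboundary c s) &
    exact_on (Y `&` \bigcup_v O v) c'.
Proof.
case: q c => // q c _ cc.
have cF v : cocycle_on (F v) c by apply: cocycle_onW cc => x [Yx Ox]; split=> //; exists v.
exists (collapse (enum I) c) => [s Ys|]; first exact: coboundary_collapse.
have [d dP] := collapse_exact (enum I) cF.
set k := collapse _ c in dP *.
have [] := @small_simplices R T I O (Y `&` \bigcup_v O v) oO _ q (k + coboundary d).
- by move=> y [_ [v _ Oy]]; exists v.
- move=> s Fs; rewrite coboundaryD coboundaryK addr0 coboundary_collapse //.
    exact: cc.
  by apply: landsW Fs => x [].
- move=> v s Fs; rewrite -[LHS]/(k s + coboundary d s) (dP v) ?F2_addrr ?mem_enum //.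
  by apply: landsW Fs => x [[Yx _] Ox].
move=> d' _ d'P; exists (d + d') => s Fs.
have := d'P s Fs; rewrite -[LHS]/(k s + coboundary d s) => /F2_move ->.
by rewrite coboundaryD.
Qed.

End Collapse.

(** * Continuity of real and planar maps *)

Section ContinuousFunctions.
Variables (R : realType) (Z : topologicalType).
Implicit Types f g : Z -> R.

Lemma cts_cst (c : R) : continuous (fun _ : Z => c).
Proof. exact: cst_continuous. Qed.

Lemma cts_add f g : continuous f -> continuous g -> continuous (fun z => f z + g z).
Proof. by move=> cf cg z; apply: continuousD; [exact: cf | exact: cg]. Qed.

Lemma cts_opp f : continuous f -> continuous (fun z => - f z).
Proof. by move=> cf z; apply: continuousN; exact: cf. Qed.

Lemma cts_mul f g : continuous f -> continuous g -> continuous (fun z => f z * g z).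
Proof. by move=> cf cg z; apply: continuousM; [exact: cf | exact: cg]. Qed.

Lemma cts_exp f n : continuous f -> continuous (fun z => f z ^+ n).
Proof.
move=> cf; elim: n => [|n IH]; first exact: cts_cst.
rewrite (_ : (fun z => _) = (fun z => f z * f z ^+ n)); first exact: cts_mul.
by apply/funext => z; rewrite exprS.
Qed.

Lemma cts_inv f : (forall z, f z != 0) -> continuous f -> continuous (fun z => (f z)^-1).
Proof. by move=> f0 cf z; apply: continuousV; [exact: f0 | exact: cf]. Qed.

Lemma cts_norm f : continuous f -> continuous (fun z => `|f z|).
Proof. by move=> cf z; apply: cvg_norm; exact: cf. Qed.

Lemma open_gt0 f : continuous f -> open [set z | 0 < f z].
Proof. move=> cf; rewrite -[[set z | _]]/(f @^-1` [set r | 0 < r]).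
by apply: open_comp => [z _|]; [exact: cf | exact: open_gt]. Qed.

End ContinuousFunctions.

Section PlanePoints.
Variables (R : realType) (V : finType).
Local Notation X := {ptws V -> (R * R)%type}.

Lemma cts_coord1 v : continuous (fun z : X => (z v).1).
Proof.
move=> z; apply: (@continuous_comp _ _ _ (fun y : X => y v) fst).
  exact: (@proj_continuous V (fun=> (R * R)%type) v).
exact: cvg_fst.
Qed.

Lemma cts_coord2 v : continuous (fun z : X => (z v).2).
Proof.
move=> z; apply: (@continuous_comp _ _ _ (fun y : X => y v) snd).
  exact: (@proj_continuous V (fun=> (R * R)%type) v).
exact: cvg_snd.
Qed.

Lemma cts_sing1 q (s : sing R X q) v : continuous (fun x => (s x v).1).
Proof.
move=> x; apply: (@continuous_comp _ _ _ s (fun y : X => (y v).1)); first exact: cts_fun.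
exact: cts_coord1.
Qed.

Lemma cts_sing2 q (s : sing R X q) v : continuous (fun x => (s x v).2).
Proof.
move=> x; apply: (@continuous_comp _ _ _ s (fun y : X => (y v).2)); first exact: cts_fun.
exact: cts_coord2.
Qed.

Lemma cts_plane (Z : topologicalType) (f : Z -> X) :
  (forall v, continuous (fun z => (f z v).1)) -> (forall v, continuous (fun z => (f z v).2)) ->
  continuous f.
Proof.
move=> c1 c2; apply: continuous_ptws => v z.
rewrite (_ : (fun x => f x v) = (fun x => ((f x v).1, (f x v).2))); last first.
  by apply/funext => x; case: (f x v).
exact: (cvg_pair (c1 v z) (c2 v z)).
Qed.

End PlanePoints.

(** * The punctured cone *)

Section Suspension.
Variables (R : realType) (V : finType) (M : simplicial_complex V).
Local Notation X := {ptws V -> (R * R)%type}.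
Implicit Types (S : {set V}) (w : X).

(* Up to homotopy the [#|S|]-fold suspension of the realization of [M]: the cone
   over [M] times a line for each vertex in [S], minus the origin. *)
Definition punctured_cone S : set X :=
  [set w | [/\ forall v, 0 <= (w v).1, [set v | (w v).1 != 0]%SET \in faces M,
    forall v, v \notin S -> (w v).2 = 0 & exists v, w v != (0, 0)]].

Lemma sum_ge0_eq0 (I : finType) (P : pred I) (F : I -> R) :
  (forall i, P i -> 0 <= F i) -> \sum_(i | P i) F i <= 0 -> forall i, P i -> F i = 0.
Proof.
move=> F0 s0; apply/psumr_eq0P => //; apply/eqP; rewrite eq_le s0.
exact: sumr_ge0.
Qed.

(** For empty [S] all second coordinates vanish, and dividing by the sum of the first ones retracts
    the punctured cone onto its base. *)
Lemma sq_nontrivial_cone n : sq_nontrivial_on R (realization R M) n ->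
  sq_nontrivial_on R (punctured_cone finset.set0) n.
Proof.
pose f w : {ptws V -> R} := fun v => (w v).1 / \sum_u (w u).1.
pose g (x : {ptws V -> R}) : X := fun v => (x v, 0).
have sum_neq0 w : punctured_cone finset.set0 w -> \sum_u (w u).1 != 0.
  move=> [w0 _ w2 [v wv]]; apply: contraNneq wv => ws.
  have := @sum_ge0_eq0 _ predT (fun u => (w u).1) (fun u _ => w0 u).
  rewrite ws lexx => /(_ isT v isT) w1; have := w2 v; rewrite inE => /(_ isT).
  by case: (w v) w1 => /= a b -> ->.
apply: (sq_nontrivial_retract (f := f) (g := g)).
- move=> q s As; apply: continuous_ptws => v; apply: cts_mul; first exact: cts_sing1.
  apply: cts_inv => [x|]; first exact/sum_neq0/As.
  by apply: continuous_sum => u; exact: cts_sing1.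
- move=> q s As; apply: cts_plane => v; last exact: cts_cst.
  move=> x; apply: (@continuous_comp _ _ _ s (fun y : {ptws V -> R} => y v)).
    exact: cts_fun.
  exact: (@proj_continuous V (fun=> R) v).
- move=> w Ww; have s0 := sum_neq0 w Ww; case: Ww => w0 wM _ _; split.
  + by move=> v; rewrite divr_ge0 // sumr_ge0.
  + by rewrite -mulr_suml divff.
  + apply: faces_sub wM; apply/fintype.subsetP => v; rewrite !inE /f.
    by apply: contraNneq => ->; rewrite mul0r.
- move=> x [x0 x1 xM]; split => //=.
  apply: contrapT => nx; have : \sum_v x v = 0; last by rewrite x1 => /eqP; rewrite oner_eq0.
  apply: big1 => v _; apply: contrapT => xv; apply: nx; exists v.
  by apply/eqP => -[].
- move=> x [x0 x1 _]; apply/funext => v; rewrite /f /g /=.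
  by under eq_bigr do rewrite /=; rewrite x1 divr1.
Qed.

Section Step.
Variables (S : {set V}) (i : V).
Hypothesis iS : i \notin S.

(** On points with nonnegative first coordinates it vanishes exactly on the axis of the second
    coordinate at [i]. *)
Let rest w := \sum_v (w v).1 + \sum_(v | v != i) `|(w v).2|.

Lemma rest_continuous : continuous rest.
Proof.
apply: cts_add; apply: continuous_sum => v; first exact: cts_coord1.
exact/cts_norm/cts_coord2.
Qed.

(** For [eps] equal to 1 or -1, and on such points, this removes the closed half of the axis
    pointing away from [eps]. *)
Let half (eps : R) : set X := [set w | 0 < eps * (w i).2] `|` [set w | 0 < rest w].

Lemma half_open eps : open (half eps).
Proof.
apply: openU; apply: open_gt0; last exact: rest_continuous.
by apply: cts_mul; [exact: cts_cst | exact: cts_coord2].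
Qed.

Let Y := punctured_cone (i |: S)%SET.

Lemma rest_eq0 w : (forall v, 0 <= (w v).1) -> ~ (0 < rest w) ->
  (forall v, (w v).1 = 0) /\ (forall v, v != i -> (w v).2 = 0).
Proof.
move=> w0 /negP; rewrite -leNgt /rest => r0.
have s1 : 0 <= \sum_v (w v).1 by exact: sumr_ge0.
have s2 : 0 <= \sum_(v | v != i) `|(w v).2| by exact: sumr_ge0.
split=> v.
  by apply: (@sum_ge0_eq0 _ predT (fun u => (w u).1)) => //; lra.
move=> vi; apply/eqP; rewrite -normr_eq0; apply/eqP.
by apply: (@sum_ge0_eq0 _ (fun u => u != i) (fun u => `|(w u).2|)) => //; lra.
Qed.

Lemma rest_gt0 w v : (forall v, 0 <= (w v).1) -> (w v).1 != 0 \/ v != i /\ (w v).2 != 0 -> 0 < rest w.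
Proof.
move=> w0 wv; apply: contrapT => /(rest_eq0 w0)[r1 r2].
case: wv => [|[vi]]; first by rewrite r1 eqxx.
by rewrite r2 ?eqxx.
Qed.

(** The straight-line contraction to the point at height [eps] on the axis never meets the removed
    half. *)
Lemma half_contractible eps q (c : cochain R X q) : eps * eps = 1 -> (0 < q)%N ->
  cocycle_on (Y `&` half eps) c -> exact_on (Y `&` half eps) c.
Proof.
case: q c => // q c e2 _.
pose h (t : R) w : X := fun v =>
  ((1 - t) * (w v).1, (1 - t) * (w v).2 + (if v == i then t * eps else 0)).
pose p : X := fun v => (0, if v == i then eps else 0).
have restM t w : 0 <= t <= 1 -> rest (h t w) = (1 - t) * rest w.
  move=> /andP[t0 t1]; rewrite /rest mulrDr !mulr_sumr; congr (_ + _).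
  apply: eq_bigr => v /negPf vi; rewrite /h /= vi addr0 normrM ger0_norm //.
  by rewrite subr_ge0.
have hY t w : 0 <= t <= 1 -> (Y `&` half eps) w -> (Y `&` half eps) (h t w).
  move=> t01 [[w0 wM wS _] wU]; have /andP[t0 t1] := t01.
  have u0 : 0 <= 1 - t by rewrite subr_ge0.
  have hU : half eps (h t w).
    have [t_eq1|t_neq1] := eqVneq t 1.
      left; rewrite /= eqxx t_eq1 subrr mul0r add0r mul1r e2; exact: ltr01.
    have u1 : 0 < 1 - t by rewrite subr_gt0 lt_neqAle t_neq1.
    case: wU => wU; [left | right].
      rewrite /= eqxx mulrDr mulrCA [eps * (t * _)]mulrCA e2 mulr1.
      by apply: ltr_wpDr => //; rewrite mulr_gt0.
    by rewrite /= restM // mulr_gt0.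
  split=> //; split.
  - by move=> v; rewrite mulr_ge0.
  - apply: faces_sub wM; apply/fintype.subsetP => v; rewrite !inE /=.
    by apply: contraNneq => ->; rewrite mulr0.
  - move=> v vS; rewrite /= wS // mulr0 add0r; move: vS; rewrite !inE.
    by case: eqP.
  - apply: contrapT => nz; have z v : h t w v = (0, 0).
      by apply/eqP; apply: contrapT => /negP hv; apply: nz; exists v.
    case: hU => hU.
      by have : 0 < eps * (h t w i).2 := hU; rewrite z mulr0 ltxx.
    have : 0 < rest (h t w) := hU.
    by rewrite /rest !big1 ?addr0 ?ltxx // => v _; rewrite z ?normr0.
apply: (@contractible_exact _ _ _ h p) => //.
- move=> k s t ct t01 As; apply: cts_plane => v /=.
    apply: cts_mul; last exact: cts_sing1.
    by apply: cts_add; [exact: cts_cst | exact: cts_opp].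
  apply: cts_add.
    apply: cts_mul; last exact: cts_sing2.
    by apply: cts_add; [exact: cts_cst | exact: cts_opp].
  by case: (v == i); [apply: cts_mul => //; exact: cts_cst | exact: cts_cst].
- have eps0 : eps != 0 by apply: contra_eqN e2 => /eqP->; rewrite mul0r eq_sym oner_eq0.
  split; last by left; rewrite /= eqxx e2 ltr01.
  split=> [v||v|] //=.
  + by rewrite (_ : [set _ | _]%SET = finset.set0) ?faces_set0 //; apply/setP => v; rewrite !inE eqxx.
  + by rewrite !inE; case: eqP.
  + by exists i; rewrite /p eqxx; apply/eqP => -[/eqP]; rewrite (negPf eps0).
- move=> w _; apply/funext => v; rewrite /h subr0 !mul1r mul0r.
  by case: ifP => _; rewrite addr0; case: (w v).
- move=> w _; apply/funext => v; rewrite /h subrr !mul0r add0r mul1r //.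
Qed.

(** The two halves are contractible. Their intersection is the complement of the whole axis and
    retracts onto [punctured_cone S] by setting the second coordinate at [i] to 0. *)
Lemma sq_nontrivial_suspension n : (0 < n)%N ->
  sq_nontrivial_on R (punctured_cone S) n -> sq_nontrivial_on R Y n.
Proof.
move=> n0 nS; apply: (@sq_nontrivial_cover R X (half 1) (half (-1))) => //; try exact: half_open.
- move=> w [w0 _ _ [v wv]].
  have [r0|r0] := pselect (0 < rest w); first by left; right.
  have [w1 w2] := rest_eq0 w0 r0.
  have vi : v = i.
    apply/eqP; apply: contraNT wv => vi; have := w1 v; have := w2 v vi.
    by case: (w v) => a b /= -> ->.
  have wi : (w i).2 != 0.
    apply: contraNneq wv; rewrite vi; have := w1 i.
    by case: (w i) => a b /= -> ->.
  by case: (ltgtP (w i).2 0) wi => // wi _; [right | left]; left => /=; lra.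
- by move=> q c; apply: half_contractible; rewrite mul1r.
- move=> q c q0 cc; exists c => //; apply: half_contractible => //.
  by rewrite mulrN1 opprK.
pose f w : X := fun v => if v == i then ((w i).1, 0) else w v.
apply: (sq_nontrivial_retract (f := f) (g := id)) nS.
- move=> q s As; apply: cts_plane => v; rewrite /f /=; case: eqP => _ /=.
  + exact: cts_sing1.
  + exact: cts_sing1.
  + exact: cts_cst.
  + exact: cts_sing2.
- by move=> q s _; exact: cts_fun.
- move=> w [[w0 wM wS wn] [wU wV]].
  have f1 v : (f w v).1 = (w v).1 by rewrite /f; case: eqP => [->|].
  have r0 : 0 < rest w.
    case: wU => // /=; rewrite mul1r => wU; case: wV => // /=; lra.
  split.
  + by move=> v; rewrite f1.
  + rewrite (_ : [set v | (f w v).1 != 0]%SET = [set v | (w v).1 != 0]%SET) //.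
    by apply/setP => v; rewrite !inE f1.
  + move=> v vS; rewrite /f; case: eqVneq => // vi; apply: wS.
    by rewrite !inE negb_or vi.
  + apply: contrapT => nz; suff : rest w = 0 by move: r0 => /[swap] ->; rewrite ltxx.
    have z v : f w v = (0, 0).
      by apply/eqP; apply: contrapT => /negP hv; apply: nz; exists v.
    rewrite /rest !big1 ?addr0 // => [v /negPf vi|v _].
      by have := z v; rewrite /f vi => ->; rewrite normr0.
    by rewrite -f1 z.
- move=> w [w0 wM wS [v wv]].
  have r0 : 0 < rest w.
    apply: (rest_gt0 (v := v) w0); have [w1|w1] := eqVneq (w v).1 0; last by left.
    have w2 : (w v).2 != 0 by apply: contraNneq wv; move: w1; case: (w v) => a b /= -> ->.
    by right; split=> //; apply: contraNneq w2 => vi; apply/eqP/wS; rewrite vi.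
  split; last by split; right.
  split=> //; last by exists v.
  by move=> u uS; apply: wS; apply: contra uS; rewrite !inE orbC => ->.
- move=> w [_ _ wS _]; apply/funext => v; rewrite /f; case: eqP => // ->.
  by have := wS i iS; case: (w i) => a b /= ->.
Qed.

End Step.

Lemma sq_nontrivial_punctured_cone n : (0 < n)%N ->
  sq_nontrivial_on R (realization R M) n ->
  sq_nontrivial_on R (punctured_cone [set: V]%SET) n.
Proof.
move=> n0 /sq_nontrivial_cone.
suff ind k : (k <= #|V|)%N -> sq_nontrivial_on R (punctured_cone finset.set0) n ->
    sq_nontrivial_on R (punctured_cone [set v in take k (enum V)]%SET) n.
  move=> /(ind _ (leqnn _)); rewrite take_oversize ?cardE //.
  by rewrite (_ : [set v in enum V]%SET = [set: V]%SET) //; apply/setP => v; rewrite !inE mem_enum.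
elim: k => [|k IH] kV nM.
  by rewrite take0 (_ : [set v in [::]]%SET = finset.set0) //; apply/setP => v; rewrite !inE.
have ks : (k < size (enum V))%N by rewrite -cardE.
have [v0 _] : exists v : V, True by case: (enum V) ks => // v; exists v.
rewrite (take_nth v0) //.
rewrite (_ : [set v in rcons _ _]%SET = (nth v0 (enum V) k |: [set v in take k (enum V)])%SET).
  apply: sq_nontrivial_suspension => //; last by apply: IH => //; exact: ltnW.
  have := take_uniq k.+1 (enum_uniq V); rewrite (take_nth v0) // rcons_uniq inE.
  by case/andP.
by apply/setP => v; rewrite !inE mem_rcons inE.
Qed.

End Suspension.

(** * Moment-angle complexes *)

Section Moebius.
Variable R : realType.
Implicit Types (c t eps : R) (p : R * R).

Definition sqnorm p : R := p.1 ^+ 2 + p.2 ^+ 2.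
(** For [eps] equal to 1 or -1, the squared distance from [p] to the point [eps] of the circle. *)
Definition sqdist eps p : R := (1 - eps * p.1) ^+ 2 + p.2 ^+ 2.

(* [mob_den c z] is the square of the norm of [1 - c z]. *)
Definition mob_den c p : R := (1 - c * p.1) ^+ 2 + (c * p.2) ^+ 2.

(* The hyperbolic translation [z |-> (z - c) / (1 - c z)] of the unit disk *)
Definition mob c p : R * R :=
  (((p.1 - c) * (1 - c * p.1) - c * p.2 ^+ 2) / mob_den c p,
   p.2 * (1 - c ^+ 2) / mob_den c p).

(** With [c = eps * t], the denominator vanishes only if [c z = 1], which in the closed disk forces
    [t = 1] and [z = eps]. *)
Lemma mob_den_gt0 eps t p : eps ^+ 2 = 1 -> 0 <= t <= 1 -> sqnorm p <= 1 ->
  0 < sqdist eps p -> 0 < mob_den (eps * t) p.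
Proof.
case: p => x y; rewrite /sqnorm /sqdist /mob_den /= => e2 /andP[t0 t1] p1 d0.
have [y0|y0] := eqVneq (t * y) 0; last first.
  have : 0 < (t * y) ^+ 2 by rewrite exprn_even_gt0.
  have := sqr_ge0 (1 - eps * t * x).
  have -> : (eps * t * y) ^+ 2 = (t * y) ^+ 2 by rewrite -mulrA exprMn e2 mul1r.
  lra.
have -> : (eps * t * y) ^+ 2 = 0 by rewrite -mulrA y0 mulr0 expr0n.
rewrite addr0 exprn_even_gt0 //=.
have [->|t_neq0] := eqVneq t 0; first by rewrite mulr0 mul0r subr0 oner_eq0.
have {}y0 : y = 0 by move/eqP: y0; rewrite mulf_eq0 (negPf t_neq0) => /eqP.
rewrite y0 expr0n /= addr0 in d0; rewrite y0 expr0n /= addr0 in p1.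
have u1 : (eps * x) ^+ 2 <= 1 by rewrite exprMn e2 mul1r.
have u2 : eps * x != 1 by apply: contraTneq d0 => ->; rewrite subrr expr0n ltxx.
have u3 : eps * x < 1 by rewrite lt_neqAle u2 /=; nra.
suff : eps * t * x < 1 by move=> h; rewrite gt_eqF ?subr_gt0.
rewrite mulrAC; move: (eps * x) u3 => a a1.
by have [u0|u0] := leP a 0; [apply: le_lt_trans ltr01; rewrite mulr_le0_ge0 | apply: le_lt_trans a1; rewrite ler_piMr // ltW].
Qed.

(** The source of the invariance of the disk, when [c] is at most 1 in absolute value, and of the
    circle. *)
Lemma mob_sqnorm c p : mob_den c p != 0 ->
  1 - sqnorm (mob c p) = (1 - c ^+ 2) * (1 - sqnorm p) / mob_den c p.
Proof.
by case: p => x y; rewrite /mob /sqnorm /mob_den /= => d0; field.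
Qed.

(** In complex notation [1 - eps mob(z)] is [(1 + t)(1 - eps z) / (1 - eps t z)], so a point other
    than [eps] never reaches [eps]. *)
Lemma mob_sqdist eps t p : eps ^+ 2 = 1 -> mob_den (eps * t) p != 0 ->
  sqdist eps (mob (eps * t) p) = (1 + t) ^+ 2 * sqdist eps p / mob_den (eps * t) p.
Proof.
move=> e2; case: p => x y; rewrite /mob /sqdist /mob_den /=.
have [->|->] : eps = 1 \/ eps = -1.
  by move/eqP: e2; rewrite sqrf_eq1 => /orP[] /eqP; [left | right].
- by move=> d0; field; apply: contraNneq d0 => <-; apply/eqP; ring.
- by move=> d0; field; apply: contraNneq d0 => <-; apply/eqP; ring.
Qed.

Lemma mob0 p : mob 0 p = p.
Proof.
case: p => x y; rewrite /mob /=.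
have -> : mob_den 0 (x, y) = 1 by rewrite /mob_den /=; ring.
by congr (_, _); field.
Qed.

(** At the end of the motion the translation degenerates: [(z - eps) / (1 - eps z)] is constant. *)
Lemma mob1 eps p : eps ^+ 2 = 1 -> 0 < sqdist eps p -> mob eps p = (- eps, 0).
Proof.
move=> e2 d0; have dE : mob_den eps p = sqdist eps p by rewrite /mob_den exprMn e2 mul1r.
rewrite /mob dE e2 subrr mulr0 mul0r; congr (_, _).
apply: (canLR (mulfK _)); first by rewrite gt_eqF.
rewrite /sqdist; case: p {d0 dE} => x y /=.
have -> : x - eps = - eps * (1 - eps * x) by rewrite mulrBr mulr1 mulrA mulNr -expr2 e2; ring.
ring.
Qed.

Lemma mob_sqnorm_le1 eps t p : eps ^+ 2 = 1 -> 0 <= t <= 1 -> 0 < sqdist eps p ->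
  sqnorm p <= 1 -> sqnorm (mob (eps * t) p) <= 1.
Proof.
move=> e2 t01 d0 p1; have D0 := mob_den_gt0 e2 t01 p1 d0.
have /andP[t0 t1] := t01.
rewrite -subr_ge0 mob_sqnorm ?gt_eqF // divr_ge0 ?(ltW D0) // mulr_ge0 ?subr_ge0 //.
by rewrite exprMn e2 mul1r expr_le1.
Qed.

Lemma mob_sqnorm_eq1 eps t p : eps ^+ 2 = 1 -> 0 <= t <= 1 -> 0 < sqdist eps p ->
  sqnorm p = 1 -> sqnorm (mob (eps * t) p) = 1.
Proof.
move=> e2 t01 d0 p1; have p1' : sqnorm p <= 1 by rewrite p1.
have D0 := mob_den_gt0 e2 t01 p1' d0.
by apply/esym/eqP; rewrite -subr_eq0 (mob_sqnorm (lt0r_neq0 D0)) p1 subrr mulr0 mul0r.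
Qed.

Lemma mob_sqdist_gt0 eps t p : eps ^+ 2 = 1 -> 0 <= t <= 1 -> 0 < sqdist eps p ->
  sqnorm p <= 1 -> 0 < sqdist eps (mob (eps * t) p).
Proof.
move=> e2 t01 d0 p1; have D0 := mob_den_gt0 e2 t01 p1 d0.
have /andP[t0 t1] := t01.
by rewrite mob_sqdist ?gt_eqF // divr_gt0 // mulr_gt0 // exprn_gt0 // ltr_wpDr.
Qed.

Lemma cts_mob (Z : topologicalType) (c a b : Z -> R) :
  continuous c -> continuous a -> continuous b -> (forall z, mob_den (c z) (a z, b z) != 0) ->
  continuous (fun z => (mob (c z) (a z, b z)).1) /\
  continuous (fun z => (mob (c z) (a z, b z)).2).
Proof.
move=> cc ca cb d0.
have cd : continuous (fun z => mob_den (c z) (a z, b z)).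
  apply: cts_add; apply: cts_exp; last exact: cts_mul.
  by apply: cts_add; [exact: cts_cst | apply: cts_opp; exact: cts_mul].
split; (apply: cts_mul; last exact: cts_inv).
  apply: cts_add.
    apply: cts_mul; first by apply: cts_add => //; exact: cts_opp.
    by apply: cts_add; [exact: cts_cst | apply: cts_opp; exact: cts_mul].
  by apply: cts_opp; apply: cts_mul => //; exact: cts_exp.
apply: cts_mul => //; apply: cts_add; first exact: cts_cst.
by apply: cts_opp; exact: cts_exp.
Qed.

End Moebius.

(** * The cover of a moment-angle complex *)

Lemma open_forall (T : topologicalType) (I : finType) (A : I -> set T) :
  (forall i, open (A i)) -> open [set x | forall i, A i x].
Proof.
move=> oA; rewrite openE => x Ax; apply: filter_forall => i.
by apply: open_nbhs_nbhs; split; [exact: oA | exact: Ax].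
Qed.

Section MomentAngle.
Variables (R : realType) (V : finType) (M : simplicial_complex V).
Local Notation X := {ptws V -> (R * R)%type}.
Implicit Types z w : X.

Let Z : set X := moment_angle R M.
(** In the notation of the overview, [U] and [O v] cut out C and F_v from [Z]. *)
Let U : set X := [set z | forall v, 0 < sqdist 1 (z v)].
Let O v : set X := [set z | 0 < sqdist (-1) (z v)].

Lemma moment_angle_disk z v : Z z -> sqnorm (z v) <= 1.
Proof. by move=> [s _ /(_ v)]; case: ifP => _ // p1; rewrite /sqnorm p1. Qed.

Lemma moment_angle_map z w : Z z ->
  (forall v, sqnorm (z v) <= 1 -> sqnorm (w v) <= 1) ->
  (forall v, sqnorm (z v) = 1 -> sqnorm (w v) = 1) -> Z w.
Proof.
move=> [s sM zs] w1 we; exists s => // v; have := zs v.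
by case: ifP => _; [exact: w1 | exact: we].
Qed.

Lemma cts_sqdist eps v : continuous (fun z => sqdist eps (z v)).
Proof.
apply: cts_add; apply: cts_exp; last exact: cts_coord2.
apply: cts_add; first exact: cts_cst.
apply: cts_opp; apply: cts_mul; [exact: cts_cst | exact: cts_coord1].
Qed.

Lemma O_open v : open (O v). Proof. exact/open_gt0/cts_sqdist. Qed.

Lemma U_open : open U.
Proof.
apply: (@open_forall _ _ (fun v z => 0 < sqdist 1 (z v))) => v.
exact/open_gt0/cts_sqdist.
Qed.

Lemma cts_mob_sing q (s : sing R X q) (c : stdsimplex R q -> R) v : continuous c ->
  (forall x, mob_den (c x) (s x v) != 0) ->
  continuous (fun x => (mob (c x) (s x v)).1) /\ continuous (fun x => (mob (c x) (s x v)).2).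
Proof.
move=> cc d0.
have eta x : s x v = ((s x v).1, (s x v).2) by case: (s x v).
have [x|c1 c2] := cts_mob cc (@cts_sing1 R V q s v) (@cts_sing2 R V q s v).
  by rewrite -eta.
split.
  by rewrite (_ : (fun x => _) = fun x => (mob (c x) ((s x v).1, (s x v).2)).1) //;
    apply/funext => x; rewrite -eta.
by rewrite (_ : (fun x => _) = fun x => (mob (c x) ((s x v).1, (s x v).2)).2) //;
  apply/funext => x; rewrite -eta.
Qed.

(** All coordinates are translated towards -1 at once; disk and circle are preserved, so the motion
    stays in [Z]. *)
Lemma U_contractible q (c : cochain R X q) : (0 < q)%N ->
  cocycle_on (Z `&` U) c -> exact_on (Z `&` U) c.
Proof.
case: q c => // q c _.
pose h t z : X := fun v => mob (1 * t) (z v).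
have e2 : 1 ^+ 2 = 1 :> R by rewrite expr1n.
have hU t z : 0 <= t <= 1 -> (Z `&` U) z -> (Z `&` U) (h t z).
  move=> t01 [Zz Uz]; split.
    apply: (moment_angle_map Zz) => v.
      exact: mob_sqnorm_le1.
    exact: mob_sqnorm_eq1.
  by move=> v; apply: mob_sqdist_gt0 => //; exact: moment_angle_disk.
apply: (@contractible_exact _ _ _ h (fun=> (-1, 0))) => //.
- move=> k s t ct t01 As.
  have ct1 : continuous (fun x => 1 * t x) by apply: cts_mul => //; exact: cts_cst.
  have den v x : mob_den (1 * t x) (s x v) != 0.
    rewrite gt_eqF // mob_den_gt0 //; first exact/moment_angle_disk/(As x).1.
    exact: (As x).2.
  by apply: cts_plane => v; have [] := cts_mob_sing ct1 (den v).
- split=> [|v].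
    exists finset.set0; first exact: faces_set0.
    by move=> v; rewrite inE /circle /=; ring.
  by rewrite /sqdist /=; lra.
- by move=> z _; apply/funext => v; rewrite /h mulr0 mob0.
- by move=> z [_ Uz]; apply/funext => v; rewrite /h mulr1 mob1.
Qed.

(** The homotopy [h v] translates the [v]-th coordinate alone towards 1, whence the parameter
    [-1 * t]; on [O v] it ends at [e v]. *)
Lemma O_primitive q (c : cochain R X q) : (0 < q)%N ->
  cocycle_on (Z `&` \bigcup_v O v) c ->
  exists2 c', (forall s : sing R X q.+1, lands Z s -> coboundary c' s = coboundary c s) &
    exact_on (Z `&` \bigcup_v O v) c'.
Proof.
pose e v z : X := fun u => if u == v then (1, 0) else z u.
pose h v t z : X := fun u => if u == v then mob (-1 * t) (z u) else z u.
have e2 : (-1) ^+ 2 = 1 :> R by rewrite sqrrN expr1n.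
have hO (v u : V) (t : R) z : 0 <= t <= 1 -> (Z `&` O v) z -> (Z `&` O u) z -> (Z `&` O u) (h v t z).
  move=> t01 [Zz Oz] [_ Ouz]; split.
    apply: (moment_angle_map Zz) => u'; rewrite /h; case: eqP => [->|] //.
      exact: mob_sqnorm_le1.
    exact: mob_sqnorm_eq1.
  rewrite /O /= /h; case: eqP => [->|] //; apply: mob_sqdist_gt0 => //.
  exact: moment_angle_disk.
have eZ v z : Z z -> Z (e v z).
  by move=> Zz; apply: (moment_angle_map Zz) => u; rewrite /e; case: eqP => // _ _;
    rewrite /sqnorm /=; lra.
have eO v z : O v (e v z) by rewrite /O /= /e eqxx /sqdist /=; lra.
apply: (@collapse_primitive _ _ _ Z O e h) => //.
- exact: O_open.
- move=> v k s _; apply: cts_plane => u; rewrite /e /=; case: eqP => _ /=.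
  + exact: cts_cst.
  + exact: cts_sing1.
  + exact: cts_cst.
  + exact: cts_sing2.
- by move=> v z Zz; split; [exact: eZ | exact: eO].
- move=> v w z [Zz Oz]; split; first exact: eZ.
  have [->|wv] := eqVneq w v; first exact: eO.
  by rewrite /O /= /e (negPf wv).
- move=> v k s t ct t01 As.
  have ct1 : continuous (fun x => -1 * t x) by apply: cts_mul => //; exact: cts_cst.
  have den x : mob_den (-1 * t x) (s x v) != 0.
    rewrite gt_eqF // mob_den_gt0 //; first exact/moment_angle_disk/(As x).1.
    exact: (As x).2.
  have [c1 c2] := cts_mob_sing ct1 den.
  apply: cts_plane => u; rewrite /h; case: eqP => [->|_] //; [exact: cts_sing1 | exact: cts_sing2].
- by move=> v z _; apply/funext => u; rewrite /h mulr0 mob0; case: eqP.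
- move=> v z [_ Oz]; apply/funext => u; rewrite /h /e mulr1; case: eqP => [->|] //.
  by rewrite mob1 // opprK.
Qed.

(** A point outside [U] has a coordinate equal to 1, which is not -1. *)
Lemma Z_cover : Z `<=` U `|` \bigcup_v O v.
Proof.
move=> z Zz; have [Uz|/existsNP[v nv]] := pselect (U z); [by left | right].
exists v => //; move/negP: nv; rewrite -leNgt /O /= /sqdist; case: (z v) => x y /= d0.
have y0 := sqr_ge0 y; have x0 := sqr_ge0 (1 - 1 * x).
have x1 : x = 1.
  have : (1 - 1 * x) ^+ 2 = 0 by lra.
  by move=> /eqP; rewrite sqrf_eq0 mul1r subr_eq0 => /eqP.
by rewrite x1; lra.
Qed.

(** In each coordinate [f] is the Cayley transform [(1 + z) / (1 - z)] and [g] its inverse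
    [(w - 1) / (w + 1)]. The disk without 1 becomes the closed right half-plane, the circle without
    1 its boundary line, and -1 the origin. *)
Lemma sq_nontrivial_cayley n : sq_nontrivial_on R (@punctured_cone R V M [set: V]%SET) n ->
  sq_nontrivial_on R (Z `&` (U `&` \bigcup_v O v)) n.
Proof.
pose f (z : X) : X := fun v =>
  ((1 - sqnorm (z v)) / sqdist 1 (z v), 2 * (z v).2 / sqdist 1 (z v)).
pose g (w : X) : X := fun v =>
  (((w v).1 ^+ 2 + (w v).2 ^+ 2 - 1) / (((w v).1 + 1) ^+ 2 + (w v).2 ^+ 2),
   2 * (w v).2 / (((w v).1 + 1) ^+ 2 + (w v).2 ^+ 2)).
have E0 w v : 0 <= (w v).1 -> 0 < ((w v).1 + 1) ^+ 2 + (w v).2 ^+ 2.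
  move=> w0; apply: ltr_wpDr; first exact: sqr_ge0.
  by apply: exprn_gt0; apply: ltr_wpDl.
have gnorm w v : 0 <= (w v).1 ->
    1 - sqnorm (g w v) = 4 * (w v).1 / (((w v).1 + 1) ^+ 2 + (w v).2 ^+ 2).
  move=> /E0; rewrite /g /sqnorm; case: (w v) => a b /= /lt0r_neq0 d0; by field.
have gdist1 w v : 0 <= (w v).1 ->
    sqdist 1 (g w v) = 4 / (((w v).1 + 1) ^+ 2 + (w v).2 ^+ 2).
  move=> /E0; rewrite /g /sqdist; case: (w v) => a b /= /lt0r_neq0 d0; by field.
have gdist2 w v : 0 <= (w v).1 ->
    sqdist (-1) (g w v) = 4 * sqnorm (w v) / (((w v).1 + 1) ^+ 2 + (w v).2 ^+ 2).
  move=> /E0; rewrite /g /sqdist /sqnorm; case: (w v) => a b /= /lt0r_neq0 d0; by field.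
apply: (sq_nontrivial_retract (f := f) (g := g)).
- move=> q s As.
  have cd v : continuous (fun x => (sqdist 1 (s x v))^-1).
    apply: cts_inv => [x|]; first by rewrite gt_eqF //; exact: (As x).2.1.
    move=> x; apply: (@continuous_comp _ _ _ s (fun y : X => sqdist 1 (y v))).
      exact: cts_fun.
    exact: cts_sqdist.
  apply: cts_plane => v; (apply: cts_mul; last exact: cd).
    apply: cts_add; first exact: cts_cst.
    by apply: cts_opp; apply: cts_add; apply: cts_exp; [exact: cts_sing1 | exact: cts_sing2].
  by apply: cts_mul; [exact: cts_cst | exact: cts_sing2].
- move=> q s As.
  have cd v : continuous (fun x => (((s x v).1 + 1) ^+ 2 + (s x v).2 ^+ 2)^-1).
    apply: cts_inv => [x|]; first by rewrite gt_eqF // E0 //; have [] := As x.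
    apply: cts_add; apply: cts_exp; last exact: cts_sing2.
    by apply: cts_add; [exact: cts_sing1 | exact: cts_cst].
  apply: cts_plane => v; (apply: cts_mul; last exact: cd).
    apply: cts_add; last exact: cts_cst.
    by apply: cts_add; apply: cts_exp; [exact: cts_sing1 | exact: cts_sing2].
  by apply: cts_mul; [exact: cts_cst | exact: cts_sing2].
- move=> z [Zz [Uz [v _ Ov]]]; split.
  + by move=> u; rewrite divr_ge0 ?subr_ge0 ?moment_angle_disk // ltW.
  + case: Zz => s sM zs; apply: faces_sub sM; apply/fintype.subsetP => u; rewrite inE.
    apply: contraR => us; have := zs u; rewrite (negPf us) /= => zu.
    by rewrite /sqnorm zu subrr mul0r.
  + by move=> u; rewrite inE.
  + exists v; apply/eqP => -[/eqP + /eqP]; rewrite !mulf_eq0 !invr_eq0 pnatr_eq0 /=.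
    have /lt0r_neq0/negPf-> := Uz v; rewrite !orbF subr_eq0 => /eqP n1 /eqP y0.
    move: n1 (Uz v) Ov; rewrite /O /= /sqnorm /sqdist y0 => n1 d1 d2; nra.
- move=> w [w0 wM _ [v wv]]; split.
    exists [set v | (w v).1 != 0]%SET => // u; rewrite inE; case: eqP => [u0|_] /=.
      have := gnorm w u (w0 u); rewrite u0 mulr0 mul0r => /eqP.
      by rewrite subr_eq0 => /eqP /esym; exact.
    suff : sqnorm (g w u) <= 1 by [].
    by rewrite -subr_ge0 gnorm // divr_ge0 ?mulr_ge0 // ltW // E0.
  split; first by move=> u; rewrite gdist1 // divr_gt0 // E0.
  exists v => //; rewrite /O /= gdist2 // divr_gt0 ?E0 // mulr_gt0 //.
  rewrite /sqnorm lt0r addr_ge0 ?sqr_ge0 // andbT paddr_eq0 ?sqr_ge0 // !sqrf_eq0.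
  by apply: contraNN wv; case: (w v) => a b /= /andP[/eqP-> /eqP->].
- move=> w [w0 _ _ _]; apply/funext => v; rewrite /f gnorm // gdist1 // /g.
  have /lt0r_neq0 := E0 w v (w0 v); case: (w v) => a b /= d0.
  by congr (_, _); field.
Qed.

Lemma sq_nontrivial_moment_angle n : (0 < n)%N ->
  sq_nontrivial_on R (realization R M) n -> sq_nontrivial_on R (moment_angle R M) n.
Proof.
move=> n0 /(sq_nontrivial_punctured_cone n0)/sq_nontrivial_cayley.
apply: sq_nontrivial_cover => //.
- exact: U_open.
- by apply: bigcup_open => v _; exact: O_open.
- exact: Z_cover.
- by move=> q c; exact: U_contractible.
- by move=> q c; exact: O_primitive.
Qed.

End MomentAngle.

(** * Full subcomplexes of the substitution complex *)

Lemma sq_nontrivial_full_subcomplex (R : realType) (V V' : finType) (M : simplicial_complex V)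
    (M' : simplicial_complex V') (iota : V -> V') n : injective iota ->
  (forall s, s \in faces M -> iota @: s \in faces M') ->
  (forall s, s \in faces M' -> iota @^-1: s \in faces M) ->
  sq_nontrivial_on R (moment_angle R M) n -> sq_nontrivial_on R (moment_angle R M') n.
Proof.
move=> iinj imM preM.
pose f (z : {ptws V' -> (R * R)%type}) : {ptws V -> (R * R)%type} := fun v => z (iota v).
(* Vertices outside the image of [iota] lie in no face [iota @: s], so their coordinate must be on
   the circle. *)
pose g (z : {ptws V -> (R * R)%type}) : {ptws V' -> (R * R)%type} := fun v' =>
  if [pick v | iota v == v'] is Some v then z v else (1, 0).
have gi z v : g z (iota v) = z v.
  rewrite /g; case: pickP => [u /eqP/iinj -> //|/(_ v)].
  by rewrite eqxx.
apply: (sq_nontrivial_retract (f := f) (g := g)).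
- by move=> q s _; apply: cts_plane => v; [exact: cts_sing1 | exact: cts_sing2].
- move=> q s _; apply: cts_plane => v'; rewrite /g /=; case: pickP => [v _|_].
  + exact: cts_sing1.
  + exact: cts_cst.
  + exact: cts_sing2.
  + exact: cts_cst.
- move=> z [s sM zs]; exists (iota @^-1: s); first exact: preM.
  by move=> v; rewrite inE; exact: zs.
- move=> z [s sM zs]; exists (iota @: s); first exact: imM.
  move=> v'; rewrite /g; case: pickP => [v /eqP <-|nv].
    by rewrite (mem_imset _ _ iinj); exact: zs.
  rewrite ifF; first by rewrite /circle /=; ring.
  by apply/negbTE/imsetP => -[v _ /eqP]; rewrite eq_sym nv.
- by move=> z _; apply/funext => v; rewrite /f gi.
Qed.

Theorem proposition6p4p2 (R : realType) (m : nat) (n_ : 'I_m -> nat)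
    (n_gt0 : forall i : 'I_m, (0 < n_ i)%N)
    (K : simplicial_complex 'I_m) (L : forall i : 'I_m, simplicial_complex 'I_(n_ i))
    (n : nat) (ge1_n : (1 <= n)%N) :
  sq_nontrivial R (set_type (realization R K)) n \/
    (exists i : 'I_m, sq_nontrivial R (set_type (realization R (L i))) n) ->
  sq_nontrivial R (set_type (moment_angle R (substitution K L))) n.
Proof.
pose Tag i (w : 'I_(n_ i)) : {i : 'I_m & 'I_(n_ i)} := Tagged (fun i => 'I_(n_ i)) w.
move=> nKL; apply/sq_nontrivial_setT/sq_nontrivial_set_type.
case: nKL => [|[i]] /sq_nontrivial_setT/sq_nontrivial_set_type/(sq_nontrivial_moment_angle ge1_n).
(* [K] is the full subcomplex on one chosen vertex of each [L i], the first one, which exists by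
   [n_gt0]. *)
- apply: (sq_nontrivial_full_subcomplex (iota := fun i => Tag i (Ordinal (n_gt0 i)))).
  + by move=> i j /(congr1 tag).
  + move=> s sK; apply/subst_facesP; exists s => //.
    exists [ffun i => [set Ordinal (n_gt0 i)]%SET] => [i _|]; first by rewrite ffunE faces_set1.
    apply/setP => -[i w]; rewrite !inE /= ffunE inE; apply/imsetP/andP => /=.
      move=> [j js /eqP]; rewrite -tag_eqE /tag_eq /= => /andP[/eqP ij].
      by subst j; rewrite tagged_asE => /eqP ->.
    by move=> [js /eqP ->]; exists i.
  + move=> r /subst_facesP[s sK [t _ ->]]; apply: faces_sub sK.
    by apply/fintype.subsetP => j; rewrite !inE /= => /andP[].
(* [L i] is the full subcomplex on the vertices with tag [i]. *)
- apply: (sq_nontrivial_full_subcomplex (iota := Tag i)).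
  + by move=> w w' /eqP; rewrite eq_Tagged => /eqP.
  + move=> s sL; apply/subst_facesP; exists [set i]%SET; first exact: faces_set1.
    exists [ffun j => [set w | Tag j w \in Tag i @: s]%SET] => [j|].
      rewrite inE ffunE => /eqP ->; rewrite (_ : [set w | _]%SET = s) //.
      apply/setP => w; rewrite inE mem_imset // => u u' /eqP.
      by rewrite eq_Tagged => /eqP.
    apply/setP => -[j w]; rewrite !inE /= ffunE inE andb_idl //.
    by move=> /imsetP[u _ /(congr1 tag) /= ->].
  + move=> r /subst_facesP[s sK [t tL ->]].
    have [is_|is_] := boolP (i \in s).
      apply: faces_sub (tL i is_); apply/fintype.subsetP => w; rewrite !inE /=.
      by case/andP.
    rewrite (_ : _ @^-1: _ = finset.set0) ?faces_set0 //; apply/setP => w.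
    by rewrite !inE /= (negPf is_).
Qed.
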